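(* The pointwise topology is the unique Polish semigroup topology on the endomorphism monoid of each of the following structures: (i) the random graph; (ii) the random directed graph; (iii) the random strict partial order; (iv) the graph $\omega\mathbb{K}_n$ for any $n\in\mathbb{N}\setminus\{0\}$; (v) the graph $n\mathbb{K}_\omega$ with loops for any $n\in(\mathbb{N}\setminus\{0\})\cup\{\omega\}$, i.e. the random equivalence relation with $n$ countably infinite equivalence classes; as well as each of the structures (i)-(iv) with all the loops included.
   Context: Each structure has a single binary relation on a countably infinite set. The random graph, random directed graph, random strict partial order are the Fra\''iss\'e limits of the classes of all finite (loopless, undirected) graphs, all finite directed graphs, all finite strict partial orders, respectively. A directed graph here is a set with an irreflexive binary relation, which need not be symmetric or antisymmetric (so both $(x,y)$ and $(y,x)$ may be edges). $\mathbb{K}_m$ is the complete (loopless) graph on $m$ vertices, and $n\mathbb{K}_m$ is the disjoint union of $n$ copies of $\mathbb{K}_m$, for cardinals $n,m\leq\omega$. A structure ''with (all the) loops'' is obtained by adding all pairs $(x,x)$ to the relation. The pointwise topology on the endomorphism monoid $\operatorname{End}(\mathbb{X})$ of a structure with domain $X$ has subbasis the sets $\{f : (x)f=y\}$, $x,y\in X$, where $(x)f$ denotes the image of $x$ under $f$. A semigroup topology on a semigroup is a topology for which multiplication is (jointly) continuous. Polish means separable and completely metrizable. *)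

(* Defs.v *)
From HB Require Import structures.
From mathcomp Require Import all_boot all_order all_algebra.
From mathcomp Require Import all_classical all_reals all_analysis.

Set Implicit Arguments.
Unset Strict Implicit.
Unset Printing Implicit Defensive.

Local Open Scope classical_set_scope.

(** * Structures with one binary relation *)

Record structure := Structure {
  dom :> Type;
  edge : dom -> dom -> Prop
}.

Definition with_loops (X : structure) : structure :=
  @Structure X (fun x y => edge x y \/ x = y).

(* The graph K_m, where the cardinal m is given by a vertex type V. *)
Definition complete_graph (V : Type) : structure :=
  @Structure V (fun x y => x <> y).

(* The disjoint union of n copies of G, where the cardinal n is given by an
   index type I. *)
Definition disjoint_copies (I : Type) (G : structure) : structure :=
  @Structure (I * G)%type (fun x y => x.1 = y.1 /\ edge x.2 y.2).

Definition simple_graph (X : structure) : Prop :=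
  (forall x : X, ~ edge x x) /\ (forall x y : X, edge x y -> edge y x).

(* Both edges (x, y) and (y, x) may be present. *)
Definition directed_graph (X : structure) : Prop :=
  forall x : X, ~ edge x x.

Definition strict_partial_order (X : structure) : Prop :=
  (forall x : X, ~ edge x x) /\
  (forall x y z : X, edge x y -> edge y z -> edge x z).

(** * Fraïssé limits *)

Definition embedding (A X : structure) (f : A -> X) : Prop :=
  injective f /\ (forall x y : A, edge x y <-> edge (f x) (f y)).

Definition automorphism (X : structure) (f : X -> X) : Prop :=
  bijective f /\ (forall x y : X, edge x y <-> edge (f x) (f y)).

Definition finite_structure (A : structure) : Prop := finite_set [set: A].

(* The age of X: the finite structures that are isomorphic to an induced
   substructure of X. *)
Definition age (X A : structure) : Prop :=
  finite_structure A /\ exists f : A -> X, embedding f.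

(* Every isomorphism f between finite induced substructures, from D onto
   f @` D, extends to an automorphism. *)
Definition ultrahomogeneous (X : structure) : Prop :=
  forall (D : set X) (f : X -> X), finite_set D ->
    (forall x y, D x -> D y -> f x = f y -> x = y) ->
    (forall x y, D x -> D y -> (edge x y <-> edge (f x) (f y))) ->
    exists g : X -> X, automorphism g /\ (forall x, D x -> g x = f x).

(* X is the Fraïssé limit of the class of all finite structures satisfying C;
   it is determined by C up to isomorphism. *)
Definition fraisse_limit (C : structure -> Prop) (X : structure) : Prop :=
  [/\ countable [set: X],
      (forall A : structure, age X A <-> finite_structure A /\ C A) &
      ultrahomogeneous X].

Definition random_graph : structure -> Prop := fraisse_limit simple_graph.

Definition random_directed_graph : structure -> Prop :=
  fraisse_limit directed_graph.

Definition random_strict_partial_order : structure -> Prop :=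
  fraisse_limit strict_partial_order.

(** * The endomorphism monoid *)

Record endo (X : structure) := Endo {
  endo_fun :> X -> X;
  endo_edge : forall x y : X, edge x y -> edge (endo_fun x) (endo_fun y)
}.

HB.instance Definition _ (X : structure) := gen_eqMixin (endo X).
HB.instance Definition _ (X : structure) := gen_choiceMixin (endo X).

Section EndoMonoid.
Variable X : structure.

Lemma endo_ext (f g : endo X) : (forall x, f x = g x) -> f = g.
Proof.
case: f g => [f hf] [g hg] /= /funext fg; rewrite -{g}fg in hg *.
by congr Endo; exact: Prop_irrelevance.
Qed.

(* Maps act on the right: (x)(f * g) = ((x)f)g. *)
Definition endo_mul (f g : endo X) : endo X :=
  @Endo X (fun x => g (f x)) (fun x y xy => endo_edge g (endo_edge f xy)).

Definition endo_one : endo X := @Endo X (fun x => x) (fun x y xy => xy).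

Lemma endo_mulA : associative endo_mul.
Proof. by move=> f g h; exact: endo_ext. Qed.

Lemma endo_mul1 : left_id endo_one endo_mul.
Proof. by move=> f; exact: endo_ext. Qed.

Lemma endo_mulr1 : right_id endo_one endo_mul.
Proof. by move=> f; exact: endo_ext. Qed.

HB.instance Definition _ :=
  isMonoid.Build (endo X) endo_mulA endo_mul1 endo_mulr1.

Definition pointwise_subbase : set_system (endo X) :=
  [set U | exists x y : X, U = [set f : endo X | f x = y]].

HB.instance Definition _ :=
  isSubBaseTopological.Build (endo X) pointwise_subbase id.

Definition pointwise_topology : Topological (endo X) :=
  Topological.on (endo X).

End EndoMonoid.

(** * Polish semigroup topologies

   As in [sup_topology], a topology on a type S is a term
   [tau : Topological S], and [Topological.Pack tau] is S with that topology. *)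

Definition separable (T : topologicalType) : Prop :=
  exists2 D : set T, countable D & dense D.

Definition complete_metric (R : realType) (M : metricType R) : Prop :=
  forall F : set_system M, ProperFilter F -> cauchy F -> exists x : M, F --> x.

Definition completely_metrizable (R : realType) (T : topologicalType) : Prop :=
  exists m : Metric R T,
    complete_metric (Metric.Pack m) /\
    @open (Metric.Pack m) = @open T.

Definition polish (R : realType) (T : topologicalType) : Prop :=
  separable T /\ completely_metrizable R T.

Definition semigroup_topology (S : semigroupType) (tau : Topological S) : Prop :=
  let T : topologicalType := Topological.Pack tau in
  continuous (fun p : T * T => (((p.1 : S) * (p.2 : S))%g : T)).

Definition polish_semigroup_topology (R : realType) (S : semigroupType)
    (tau : Topological S) : Prop :=
  polish R (Topological.Pack tau) /\ semigroup_topology tau.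

(* Two topologies are identified when they have the same open sets. *)
Definition unique_polish_semigroup_topology (R : realType) (S : semigroupType)
    (tau : Topological S) : Prop :=
  polish_semigroup_topology R tau /\
  forall sigma : Topological S, polish_semigroup_topology R sigma ->
    @open (Topological.Pack sigma) = @open (Topological.Pack tau).

Definition pointwise_unique_polish (R : realType) (X : structure) : Prop :=
  @unique_polish_semigroup_topology R (endo X) (pointwise_topology X).

(* Main.v *)
(** The pointwise topology P on S = End(X) is contained in every Hausdorff
   semigroup topology as soon as each set {f | f x = y} is a finite intersection
   of sets {f | a * f * b <> c * f * d} and {f | a * f <> b}, which are open in
   all such topologies.

   Conversely let sigma be a Polish semigroup topology containing P. The
   automorphism group A is Baire for P and, sigma being second countable, it is
   covered by countably many translates of W = {h in V | h^-1 in V} for every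
   sigma-neighbourhood V of 1; so the P-closure of W * W^-1, hence of V * V,
   contains a P-neighbourhood of 1 in A. If every s in S factors as s = f * g so
   that automorphisms h close to 1 make f * h * g approximate, in P, all
   endomorphisms close to s, then near-openness passes from A to S, and Weston's
   lemma gives sigma = P.

   For a Fraïssé limit X such a factorization is obtained from a free extension
   of X: adjoin points one at a time, with as few relations as possible and with
   prescribed values under an extension g of s, until the result is isomorphic
   to X; then f is the inclusion. For disjoint unions of complete graphs it
   suffices to let g take each value (or, for finite components, each map onto
   a component) infinitely often outside the range of f. *)
Require Import Defs.
From HB Require Import structures.
From mathcomp Require Import finmap.
From mathcomp Require Import all_boot all_order all_algebra.
From mathcomp Require Import all_classical all_reals all_analysis.
From mathcomp Require Import ring lra.
Set Implicit Arguments.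
Unset Strict Implicit.
Unset Printing Implicit Defensive.
Import Order.TTheory GRing.Theory Num.Theory.
Local Open Scope classical_set_scope.
Local Open Scope ring_scope.

(** * Completely metrizable topologies and nearly open maps *)

(** A bare function on the given space, rather than a metric structure with a topology of its own,
    so that [open] always refers to [T]. Completeness is sequential. *)
Definition complete_distance (R : realType) (T : topologicalType)
    (d : T -> T -> R) : Prop :=
  [/\ (forall x y, d x y = d y x),
      (forall x y z, d x z <= d x y + d y z),
      (forall U : set T, open U <->
         forall x, U x -> exists2 e, 0 < e & forall y, d x y < e -> U y) &
      (forall u : nat -> T,
         (forall e, 0 < e -> exists N, forall m n, (N <= m)%N -> (N <= n)%N ->
            d (u m) (u n) < e) ->
         exists l, forall e, 0 < e -> exists N, forall n, (N <= n)%N ->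
            d l (u n) < e)].

Lemma complete_metric_seq (R : realType) (M : metricType R) (u : nat -> M) :
  complete_metric M ->
  (forall e : R, 0 < e -> exists N, forall m n, (N <= m)%N -> (N <= n)%N ->
     mdist (u m) (u n) < e) ->
  exists l, forall e : R, 0 < e -> exists N, forall n, (N <= n)%N ->
     mdist l (u n) < e.
Proof.
move=> cM cu.
have [|l ul] := cM (u @ \oo) _.
  apply: cauchy_exP => e e0; have [N uN] := cu e e0.
  exists (u N); exists N => // n /= Nn; rewrite ballEmdist /=.
  exact: uN.
exists l => e e0.
have /ul [N _ uN] : nbhs l (ball l e) by exact: nbhsx_ballx.
by exists N => n Nn; have := uN n Nn; rewrite ballEmdist.
Qed.

Lemma open_mdist (R : realType) (M : metricType R) (U : set M) :
  open U <-> forall x, U x -> exists2 e : R, 0 < e & forall y, mdist x y < e -> U y.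
Proof.
rewrite openE; split=> UU x /UU.
  rewrite /interior /= -nbhs_ballE => -[e /= e0 eU].
  by exists e => // y xy; apply: eU; rewrite ballEmdist.
move=> [e e0 eU]; rewrite /interior -nbhs_ballE.
by exists e => //= y; rewrite ballEmdist; exact: eU.
Qed.

Lemma completely_metrizable_distance (R : realType) (T : topologicalType) :
  completely_metrizable R T -> exists d : T -> T -> R,
  complete_distance d /\ (forall x y, d x y = 0 <-> x = y).
Proof.
move=> [m [cm om]]; pose M : metricType R := Metric.Pack m.
exists (fun x y : T => mdist (x : M) (y : M)); split; last first.
  move=> x y; split=> [|->]; first exact: (@mdist_positivity _ M).
  exact: (@mdistxx _ M).
split.
- exact: (@metric_sym _ M).
- exact: (@metric_triangle _ M).
- move=> U; rewrite -om; exact: open_mdist.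
- move=> u; exact: complete_metric_seq.
Qed.

Lemma exists_inv_nat_lt (R : realType) (e : R) :
  0 < e -> exists n, n.+1%:R^-1 < e.
Proof.
move=> e0; exists (Num.bound e^-1); rewrite invf_plt ?posrE //.
by apply: (lt_le_trans (archi_boundP _)); rewrite ?ler_nat // invr_ge0 ltW.
Qed.

Lemma exists_half_pow_lt (R : realType) (c e : R) :
  0 < c -> 0 < e -> exists n, c / 2 ^+ n < e.
Proof.
move=> c0 e0; have [n ne] := exists_inv_nat_lt (divr_gt0 e0 c0).
exists n; rewrite mulrC -ltr_pdivlMr //; apply: le_lt_trans ne.
by rewrite lef_pV2 ?posrE ?exprn_gt0 // -natrX ler_nat ltn_expl.
Qed.

Lemma completely_metrizable_hausdorff (R : realType) (T : topologicalType) :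
  completely_metrizable R T -> hausdorff_space T.
Proof.
move=> [m [_ om]].
have := @metric_hausdorff _ (Metric.Pack m); rewrite !open_hausdorff => H x y xy.
have [|AB ABxy [oA oB AB0]] := H x y; first by apply/eqP => xy'; case/eqP: xy.
by exists AB => //; split => //; rewrite -om.
Qed.

Lemma separable_second_countable (R : realType) (T : topologicalType)
    (d : T -> T -> R) : complete_distance d -> (forall x, d x x = 0) ->
  separable T ->
  exists B : nat -> set T, (forall n, open (B n)) /\
    forall U x, open U -> U x -> exists2 n, B n x & B n `<=` U.
Proof.
move=> [ds dt dopen _] dxx [D cD dD].
have bopen x e : open [set y | d x y < e].
  apply/dopen => y /= xy; exists (e - d x y); first by rewrite subr_gt0.
  by move=> z yz; apply: (le_lt_trans (dt x y z)); rewrite -ltrBrDl.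
have /countable_injP[c cinj] := cD.
(* [B n] is the ball coded by [n], and is empty when [n] codes none; [c] is injective on [D], so no
   two centres share a code. *)
pose B n := [set y | exists k x, [/\ n = pickle (k, c x), D x & d x y < k.+1%:R^-1]].
exists B; split.
  move=> n; apply/dopen => y [k [x [-> Dx xy]]].
  have /dopen/(_ y)[//|e e0 H] := bopen x (k.+1%:R^-1).
  by exists e => // z /H ?; exists k, x.
move=> U x oU Ux.
have /dopen/(_ x Ux)[e e0 eU] := oU.
have [k ke] : exists k, k.+1%:R^-1 < e / 2.
  by apply: exists_inv_nat_lt; rewrite divr_gt0.
have [z [xz Dz]] : [set y | d x y < k.+1%:R^-1] `&` D !=set0.
  by apply: dD => //; exists x => /=; rewrite dxx invr_gt0.
exists (pickle (k, c z)); first by exists k, z; split=> //; rewrite ds.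
move=> y [k' [z' [/(pcan_inj pickleK) [kk' zz'] Dz' z'y]]].
have {zz' Dz'}zz' : z = z' by apply: cinj => //; rewrite inE.
rewrite -{}zz' -{}kk' in z'y.
apply: eU; apply: (le_lt_trans (dt x z y)).
rewrite [e]splitr; apply: ltrD; apply: lt_trans ke => //.
Qed.

Lemma semigroup_topology_open (S : semigroupType) (tau : Topological S)
    (T := Topological.Pack tau) : semigroup_topology tau ->
  forall (U : set T) (x y : S), open U -> U (x * y)%g ->
  exists V W : set T, [/\ open V, open W, V x, W y &
    forall a b : S, V a -> W b -> U (a * b)%g].
Proof.
move=> cT U x y oU Uxy.
have H : forall A, @nbhs _ T (x * y)%g A -> _ := cT (x, y).
have /H : nbhs ((x * y)%g : T) U by apply: (@open_nbhs_nbhs T); split.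
case=> -[A B] /= [Ax By] AB.
exists (interior A), (interior B); split.
- exact: open_interior.
- exact: open_interior.
- exact: Ax.
- exact: By.
- move=> a b aA bB; apply: (AB (a, b)); split.
  exact: (@interior_subset T A a aA).
  exact: (@interior_subset T B b bB).
Qed.

(** The distances telescope to at most [2 * c / 2 ^+ k] from [u k] on; the bound [3 * c] leaves one
    more [c] for the passage to the limit. *)
Lemma geometric_limit (R : realType) (T : topologicalType) (d : T -> T -> R)
    (u : nat -> T) (c : R) : complete_distance d -> (forall x, d x x = 0) ->
  0 < c -> (forall k, d (u k) (u k.+1) < c / 2 ^+ k) ->
  exists l, d (u 0%N) l <= 3 * c /\ forall e, 0 < e -> exists N, forall n, (N <= n)%N -> d l (u n) < e.
Proof.
move=> [ds dt _ dc] dxx c0 uc.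
have um m : forall k, d (u k) (u (k + m)%N) <= 2 * c / 2 ^+ k.
  elim: m => [|m IH] k.
    by rewrite addn0 dxx divr_ge0 ?exprn_ge0 // mulr_ge0 ?ltW.
  apply: (le_trans (dt _ (u k.+1) _)).
  have -> : 2 * c / 2 ^+ k = c / 2 ^+ k + 2 * c / 2 ^+ k.+1.
    by rewrite exprS; field; rewrite expf_neq0.
  by apply: lerD; [exact: ltW | rewrite addnS -addSn].
have [|l ul] := dc u.
  move=> e e0.
  have [N Ne] : exists N, 2 * c / 2 ^+ N < e / 2.
    by apply: exists_half_pow_lt; rewrite ?mulr_gt0 ?divr_gt0.
  exists N => m n Nm Nn; rewrite -(subnKC Nm) -(subnKC Nn).
  apply: (le_lt_trans (dt _ (u N) _)); rewrite ds.
  by have := um (m - N)%N N; have := um (n - N)%N N; lra.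
exists l; split=> //.
have [N uN] := ul c c0.
have := dt (u 0%N) (u N) l; rewrite (ds (u N) l).
by have := uN N (leqnn N); have := um N 0%N; rewrite add0n expr0 divr1; lra.
Qed.

(* Given [y] in the interior of the closure of a small ball around [x], choose
   points near [x] and near [y] alternately, each in the closure of a smaller
   ball around the previous one; both sequences converge, and to the same limit
   since [T2] is Hausdorff. *)
Lemma weston (R : realType) (S : Type) (sigma tau : Topological S)
    (T1 := Topological.Pack sigma) (T2 := Topological.Pack tau) :
  completely_metrizable R T1 -> hausdorff_space T2 ->
  (forall U : set S, @open T2 U -> @open T1 U) ->
  (forall (V : set S) (x : S), @open T1 V -> V x ->
     @nbhs _ T2 x (@closure T2 V)) ->
  forall U : set S, @open T1 U -> @open T2 U.
Proof.
move=> /completely_metrizable_distance[d [cd d0]] hT2 ts near U oU.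
have dxx x : d x x = 0 by apply/d0.
have [ds dt dopen _] := cd.
rewrite openE => x0 Ux0; rewrite /interior.
have [e e0 eU] := (dopen U).1 oU x0 Ux0.
(* Each limit will lie within [3 * r] of its starting point, [x0] or [y], so [d x0 y <= 6 * r < e]
   once the limits agree. *)
pose r := e / 7; have r0 : 0 < r by rewrite divr_gt0.
pose B (x : S) a : set S := [set y | d x y < a].
have oB x a : @open T1 (B x a).
  apply/dopen => y /= xy; exists (a - d x y); first by rewrite subr_gt0.
  by move=> z yz; apply: (le_lt_trans (dt x y z)); rewrite -ltrBrDl.
have nB (x : S) a : 0 < a -> @nbhs _ T2 x (@closure T2 (B x a)).
  by move=> a0; apply: near; rewrite ?oB // /B /= dxx.
pose a n := r / 2 ^+ n.
have a0 n : 0 < a n by rewrite divr_gt0 ?exprn_gt0.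
apply: (filterS _ (@nbhs_interior T2 _ _ (nB x0 (a 0%N) (a0 0%N)))) => y Qy.
pose Q n (p : S * S) := @interior T2 (@closure T2 (B p.1 (a n))) p.2.
have [step stepP] : {step : nat * (S * S) -> S * S & forall np,
    Q np.1 np.2 -> [/\ (step np).1 = np.2.2, d np.2.1 (step np).2 < a np.1 &
                      Q np.1.+1 (step np)]}.
  apply: (@choice _ _ (fun np q => Q np.1 np.2 -> [/\ q.1 = np.2.2,
     d np.2.1 q.2 < a np.1 & Q np.1.+1 q])) => -[n [x z]] /=.
  have [Qn|nQ] := pselect (Q n (x, z)); last by exists (x, z).
  have /(_ _ (@nbhs_interior T2 _ _ (nB z (a n.+1) (a0 n.+1)))) := 
    interior_subset Qn.
  by move=> [w [Bw Iw]]; exists (z, w).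
(* The terms [(z n).1] begin with [x0] and [y]. Those of even index converge near [x0], those of odd
   index near [y], and each [(z n).2], the next term, is interior to the closure of the ball of
   radius [a n] around [(z n).1]. *)
pose z := fix z n := if n is m.+1 then step (m, z m) else (x0, y).
have zQ n : Q n (z n).
  by elim: n => // n IH; have [] := stepP (n, z n) IH.
have z1 n : (z n.+1).1 = (z n).2 by have [] := stepP (n, z n) (zQ n).
have zd n : d (z n).1 (z n.+1).2 < a n by have [] := stepP (n, z n) (zQ n).
have zd' n : d (z n).1 (z n.+2).1 < a n by rewrite z1.
have a_le m n : (n <= m)%N -> a m <= a n.
  by move=> nm; rewrite ler_pM2l // lef_pV2 ?posrE ?exprn_gt0 // ler_eXn2l // ltr1n.
have [|l [x0l ul]] := @geometric_limit R T1 d (fun k => (z k.*2).1) r cd dxx r0.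
  by move=> k; apply: (lt_le_trans (zd' _)); apply: a_le; rewrite -addnn leq_addr.
have [|l' [yl' ul']] := @geometric_limit R T1 d (fun k => (z k.*2.+1).1) r cd dxx r0.
  move=> k; apply: (lt_le_trans (zd' _)); apply: a_le.
  by rewrite -addnn -addnS leq_addr.
suff ll' : l = l'.
  rewrite -{}ll' z1 /= in yl'; rewrite /= in x0l.
  apply: eU; apply: (le_lt_trans (dt _ l _)); rewrite (ds l).
  have -> : e = 7 * r by rewrite /r; field.
  lra.
apply: contrapT => nll'.
have ll' : (l : T2) != l' by apply/eqP.
have := hT2; rewrite open_hausdorff => /(_ l l' ll') [[M M'] /= [lM l'M']].
move=> [oM oM' /eqP MM']; rewrite !inE in lM l'M'.
have [b b0 bM] := (dopen M).1 (ts _ oM) l lM.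
have [b' b'0 bM'] := (dopen M').1 (ts _ oM') l' l'M'.
have [N HN] := ul (b / 2) ltac:(by rewrite divr_gt0).
have [N' HN'] := ul' b' b'0.
have [N2 HN2] : exists N2, a N2 < b / 2.
  by apply: exists_half_pow_lt => //; rewrite divr_gt0.
pose k := maxn (maxn N N') N2.
have kN : (N <= k)%N by rewrite !leq_max leqnn.
have kN' : (N' <= k)%N by rewrite !leq_max leqnn orbT.
have kN2 : (N2 <= k.*2)%N.
  by rewrite -addnn; apply: (@leq_trans k); rewrite ?leq_addr // leq_max leqnn orbT.
(* The odd term [(z k.*2).2] is in [M'] and in the closure of a ball around the preceding even term;
   this ball is contained in [M], so [M'] meets [M]. *)
have := interior_subset (zQ k.*2) => /(_ M') [].
  have : M' (z k.*2).2 by rewrite -z1; apply: bM'; exact: HN'.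
  by move=> ?; exact: (@open_nbhs_nbhs T2).
move=> w [Bw M'w]; have : (M `&` M') w.
  split => //; apply: bM; apply: (le_lt_trans (dt _ (z k.*2).1 _)).
  have := HN k kN; have := a_le _ _ kN2; rewrite /B /= in Bw; lra.
by rewrite MM'.
Qed.

(** * Zariski-open sets and the pointwise topology *)

(** Finite systems of inequations in one unknown [f]: basic open sets of the semigroup Zariski
    topology, restricted to two shapes of inequation. *)
Inductive zariski_open (S : semigroupType) : set S -> Prop :=
| zariski_neq (a b c d : S) :
    zariski_open [set f | (a * f * b)%g <> (c * f * d)%g]
| zariski_neq_cst (a b : S) : zariski_open [set f | (a * f)%g <> b]
| zariski_setI (U V : set S) :
    zariski_open U -> zariski_open V -> zariski_open (U `&` V).

(** Both sides of an inequation are continuous in [f], and two continuous maps into a Hausdorff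
    space differ on an open set. *)
Lemma zariski_open_open (S : semigroupType) (tau : Topological S)
    (T := Topological.Pack tau) : semigroup_topology tau -> hausdorff_space T ->
  forall U : set S, zariski_open U -> @open T U.
Proof.
move=> cT hT.
have oneq (p q : S -> S) :
    (forall V : set S, @open T V -> @open T [set f | V (p f)]) ->
    (forall V : set S, @open T V -> @open T [set f | V (q f)]) ->
    @open T [set f | p f <> q f].
  move=> cp cq; rewrite openE => f /= pqf.
  have npq : (p f : T) != q f by apply/eqP.
  have := hT; rewrite open_hausdorff => /(_ _ _ npq) [[M N] /= [Mp Nq]].
  move=> [oM oN /eqP MN]; rewrite !inE in Mp Nq.
  have pM : @nbhs _ T f [set f | M (p f)].
    by apply: (@open_nbhs_nbhs T); split=> //; exact: cp.
  have qN : @nbhs _ T f [set f | N (q f)].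
    by apply: (@open_nbhs_nbhs T); split=> //; exact: cq.
  apply: filterS (filterI pM qN) => g [/= Mg Ng] pqg.
  have : (M `&` N) (p g) by split=> //; rewrite pqg.
  by rewrite MN.
have cl (a : S) (V : set S) : @open T V -> @open T [set f | V (a * f)%g].
  move=> oV; rewrite openE => f /=.
  move=> /(semigroup_topology_open cT oV)[A [B [_ oB Aa Bf AB]]].
  apply: (@filterS T (nbhs f) _ B) => [g /(AB _ _ Aa)//|].
  exact: (@open_nbhs_nbhs T).
have cr (a : S) (V : set S) : @open T V -> @open T [set f | V (f * a)%g].
  move=> oV; rewrite openE => f /=.
  move=> /(semigroup_topology_open cT oV)[A [B [oA _ Af Ba AB]]].
  apply: (@filterS T (nbhs f) _ A) => [g Ag|]; first exact: AB.
  exact: (@open_nbhs_nbhs T).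
move=> U; elim=> [a b c d|a b|V W _ oV _ oW].
- by apply: oneq => V oV; exact: (cl _ [set f | V (f * _)%g] (cr _ _ oV)).
- apply: oneq => V oV; first exact: cl.
  have [Vb|Vb] := pselect (V b).
    by rewrite (_ : [set _ | _] = setT); [exact: openT | apply/seteqP; split].
  by rewrite (_ : [set _ | _] = set0); [exact: open0 | apply/seteqP; split].
- exact: openI.
Qed.

(** * The pointwise topology is a Polish semigroup topology *)

Section PointwiseTopology.
Variables (R : realType) (T : countType) (E : T -> T -> Prop).
Notation X := (@Structure T E).
Notation S := (endo X).
Implicit Types (f g h s : S) (U : set S).

Lemma nbhs_pointwise s U :
  nbhs s U <-> exists D : seq T, forall s', {in D, s' =1 s} -> U s'.
Proof.
split.
  rewrite nbhsE => -[V [[B Bsub <-] [W BW Ws]] VU].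
  have [F Fsub WF] := Bsub _ BW.
  have {}WF : W = \bigcap_(A in [set` F]) A by rewrite -WF.
  have {}Ws : W s by [].
  (* [t A] is the finite support of a subbasic set [A] containing [s]; for other sets the condition
     is void. *)
  have /choice[t tP] : forall A : set S, exists l : seq T,
      pointwise_subbase A -> A s -> forall f : S, {in l, f =1 s} -> A f.
    move=> A; have [[[x [y ->]] /= As]|nA] :=
      pselect (pointwise_subbase A /\ A s); last by exists [::] => *; case: nA.
    by exists [:: x] => _ _ f /(_ x (mem_head _ _)) ->.
  exists (flatten [seq t A | A <- (F : seq _)]) => s' s's.
  apply: VU; exists W => //; change (W s'); rewrite WF => A FA /=.
  have sbA : pointwise_subbase A by have /[!inE] := Fsub _ FA.
  have As : A s by move: Ws; rewrite WF; apply.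
  apply: (tP A sbA As) => x xA; apply: s's; apply/flattenP.
  by exists (t A) => //; apply: map_f.
move=> [D DU].
suff : nbhs s [set s' : S | {in D, s' =1 s}] by apply: filterS.
elim: D {DU} => [|x D IH].
  by apply: filterS filterT => f _ y; rewrite in_nil.
have xs : nbhs s [set f : S | f x = s x].
  apply: open_nbhs_nbhs; split=> //.
  exists [set [set f : S | f x = s x]]; last by rewrite bigcup_set1.
  move=> _ ->; exists [fset [set f : S | f x = s x]]%fset.
    by move=> A /fset1P ->; rewrite in_setE; exists x, (s x).
  by apply/seteqP; split => f /=; rewrite set_fset1 bigcap_set1.
apply: filterS (filterI xs IH) => f [/= fx fD] z; rewrite inE => /orP[/eqP->//|].
exact: fD.
Qed.

(** For [f <> g], [r] is [1 / (n + 1)] with [n] the least code of a point where they differ. *)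
Lemma exists_first_difference f g : exists r : R,
  [/\ f = g -> r = 0, forall x, f x <> g x -> (pickle x).+1%:R^-1 <= r &
    f <> g -> exists2 x, f x <> g x & r = (pickle x).+1%:R^-1].
Proof.
have [->|fg] := pselect (f = g); first by exists 0.
have dfg : exists n, `[< exists2 x, f x <> g x & pickle x = n >].
  have [x fgx] : exists x, f x <> g x.
    by apply: contrapT => /forallNP nfg; apply/fg/endo_ext => x; exact: contrapT (nfg x).
  by exists (pickle x); apply/asboolP; exists x.
case: (ex_minnP dfg) => n /asboolP [x fgx xn] nmin.
exists n.+1%:R^-1; split => // [y fgy|_]; last by exists x; rewrite ?xn.
by rewrite lef_pV2 ?posrE // ler_nat; apply/nmin/asboolP; exists y.
Qed.

Definition first_difference f g : R := projT1 (cid (exists_first_difference f g)).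

Lemma first_difference_ge f g x :
  f x <> g x -> (pickle x).+1%:R^-1 <= first_difference f g.
Proof. by rewrite /first_difference; case: cid => r [_ + _] /=; apply. Qed.

Lemma first_difference_neq f g : f <> g ->
  exists2 x, f x <> g x & first_difference f g = (pickle x).+1%:R^-1.
Proof. by rewrite /first_difference; case: cid => r [_ _ +] /=; apply. Qed.

Lemma first_difference_xx f : first_difference f f = 0.
Proof. by rewrite /first_difference; case: cid => r [+ _ _] /=; apply. Qed.

Lemma first_difference_eq0 f g : first_difference f g = 0 -> f = g.
Proof.
move=> fg0; apply: contrapT => /first_difference_neq[x _].
by rewrite fg0 => /esym/eqP; rewrite invr_eq0 pnatr_eq0.
Qed.

Lemma first_difference_sym f g : first_difference f g = first_difference g f.
Proof.
have le f' g' : first_difference f' g' <= first_difference g' f'.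
  have [->//|/first_difference_neq[x fgx ->]] := pselect (f' = g').
  by apply: first_difference_ge; exact: nesym.
by apply/eqP; rewrite eq_le !le.
Qed.

Lemma first_difference_ge0 f g : 0 <= first_difference f g.
Proof.
have [->|/first_difference_neq[x _ ->]] := pselect (f = g).
  by rewrite first_difference_xx.
by rewrite invr_ge0.
Qed.

Lemma first_difference_triangle g f h :
  first_difference f h <= first_difference f g + first_difference g h.
Proof.
have [->|/first_difference_neq[x fhx ->]] := pselect (f = h).
  by rewrite first_difference_xx addr_ge0 // first_difference_ge0.
have [fgx|fgx] := pselect (f x = g x).
  apply: (le_trans (first_difference_ge (f := g) (g := h) _)); first by rewrite -fgx.
  by rewrite lerDr first_difference_ge0.
apply: (le_trans (first_difference_ge fgx)).
by rewrite lerDl first_difference_ge0.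
Qed.

(** A copy of the monoid to carry the metric, since [endo X] itself already carries the pointwise
    topology. *)
Definition metric_endo : Type := S.
HB.instance Definition _ := Choice.on metric_endo.
HB.instance Definition _ := isMetric.Build R metric_endo first_difference_xx
  first_difference_eq0 first_difference_sym first_difference_triangle.

Lemma first_difference_lt f g n : first_difference f g < n.+1%:R^-1 <->
  forall x, (pickle x <= n)%N -> f x = g x.
Proof.
split=> [fgn x xn|fgn].
  apply: contrapT => /first_difference_ge /le_lt_trans /(_ fgn).
  by rewrite ltf_pV2 ?posrE // ltr_nat ltnS ltnNge xn.
have [->|/first_difference_neq[x fgx ->]] := pselect (f = g).
  by rewrite first_difference_xx.
rewrite ltf_pV2 ?posrE // ltr_nat ltnS ltnNge; apply/negP => xn.
exact/fgx/fgn.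
Qed.

Lemma open_metric_endo : @open metric_endo = @open S.
Proof.
apply/funext => U; apply/propext; rewrite (@open_mdist R metric_endo) openE; split.
  move=> UU s /UU [e /exists_inv_nat_lt [n ne] sU].
  apply/nbhs_pointwise; exists (pmap unpickle (iota 0 n.+1)) => s' s's.
  apply: sU; apply: lt_trans ne; apply/first_difference_lt => x xn.
  rewrite s's // mem_pmap; apply/mapP; exists (pickle x); last by rewrite pickleK.
  by rewrite mem_iota.
move=> UU s /UU /nbhs_pointwise [D DU].
exists ((\max_(x <- D) pickle x).+1%:R^-1); first by rewrite invr_gt0.
move=> s' /first_difference_lt ss'; apply: DU => x xD.
by rewrite ss' //; apply: leq_bigmax_seq.
Qed.

(** A Cauchy filter eventually fixes the image of each point. The pointwise limit preserves an edge
    because it agrees at the two end points with some endomorphism. *)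
Lemma complete_metric_endo : complete_metric metric_endo.
Proof.
move=> F PF /cauchyP cF.
have small n : exists f, F [set g | forall x, (pickle x <= n)%N -> f x = g x].
  have [f Ff] := cF n.+1%:R^-1 ltac:(by rewrite invr_gt0).
  exists f; apply: filterS Ff => g; rewrite ballEmdist /= => fg.
  exact/first_difference_lt.
have [u uF] := choice small.
pose l x := u (pickle x) x.
have lF n : F [set g | forall x, (pickle x <= n)%N -> l x = g x].
  elim: n => [|n IH].
    by apply: filterS (uF 0) => g gu x; rewrite leqn0 /l => /eqP x0; rewrite x0 gu ?x0.
  apply: filterS (filterI IH (uF n.+1)) => g [/= gl gu] x.
  by rewrite leq_eqVlt ltnS => /orP[/eqP xn|/gl//]; rewrite /l xn gu ?xn.
have ledge x y : E x y -> E (l x) (l y).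
  move=> xy; have /filter_ex[g gl] := lF (maxn (pickle x) (pickle y)).
  by rewrite !gl ?leq_maxl ?leq_maxr //; exact: (@endo_edge X g).
exists (@Endo X l ledge) => A.
rewrite -nbhs_ballE => -[e /= /exists_inv_nat_lt [n ne] eA].
apply: filterS (lF n) => g gl; apply: eA.
by rewrite ballEmdist /=; apply: lt_trans ne; apply/first_difference_lt.
Qed.

(** One endomorphism is chosen for each finite list of prescribed values that is attainable; there
    are countably many such lists. *)
Lemma separable_endo : separable S.
Proof.
have /choice[c cP] : forall l : seq (T * T), exists f : S,
    (exists f' : S, {in l, forall p, f' p.1 = p.2}) -> {in l, forall p, f p.1 = p.2}.
  move=> l; have [[f fl]|nl] := pselect (exists f' : S, {in l, forall p, f' p.1 = p.2}).
    by exists f.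
  by exists 1%g.
exists (range c).
  by apply: sub_countable (card_image_le _ _) _; exact: countableP.
move=> O [s Os] oO.
have /nbhs_pointwise[D DO] : nbhs s O by exact: open_nbhs_nbhs.
pose l := [seq (x, s x) | x <- D].
exists (c l); split; last by exists l.
apply: DO => x xD; apply: (cP l _ (x, s x)); last by apply: map_f.
by exists s => p /mapP[y _ ->].
Qed.

Lemma pointwise_semigroup_topology : semigroup_topology (pointwise_topology X).
Proof.
move=> [f g] U /(nbhs_pointwise ((f : S) * (g : S))%g) [D DU].
exists ([set f' : S | {in D, f' =1 f}], [set g' : S | {in map f D, g' =1 g}]).
  by split => /=; apply/nbhs_pointwise; [exists D | exists (map f D)].
case=> f' g' [/= f'f g'g]; apply: DU => x xD /=.
by rewrite f'f // g'g // map_f.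
Qed.

Lemma pointwise_polish_semigroup_topology :
  polish_semigroup_topology R (pointwise_topology X).
Proof.
split; last exact: pointwise_semigroup_topology.
split; first exact: separable_endo.
exists (Metric.on metric_endo); split; first exact: complete_metric_endo.
exact: open_metric_endo.
Qed.

End PointwiseTopology.

(** * A criterion for uniqueness *)

Section Criterion.
Variables (R : realType) (T : countType) (E : T -> T -> Prop).
Notation X := (@Structure T E).
Notation S := (endo X).
Implicit Types (f g h s : S) (U : set S).

(** Automorphisms are carried as pairs of endomorphisms: preservation of edges by the inverse is
    then built in. *)
Definition mutually_inverse h h' := cancel h h' /\ cancel h' h.

Lemma mutually_inverse_mul g g' h h' : mutually_inverse g g' ->
  mutually_inverse h h' -> mutually_inverse (g * h)%g (h' * g')%g.
Proof.
by move=> [gK g'K] [hK h'K]; split=> x /=; rewrite ?hK ?gK ?g'K ?h'K.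
Qed.

Lemma mutually_inverse_mulV h h' : mutually_inverse h h' ->
  (h * h')%g = 1%g /\ (h' * h)%g = 1%g.
Proof. by move=> [hK h'K]; split; apply: endo_ext => x /=; rewrite ?hK ?h'K. Qed.

(** Baire category for the automorphism group: some [C n] is dense near some automorphism [g].
    Otherwise automorphisms can be refined on growing finite sets, step [n] escaping [C n], and
    their limit is an automorphism in no [C n]. *)
Lemma automorphisms_baire (C : nat -> set S) :
  (forall h h', mutually_inverse h h' -> exists n, C n h) ->
  exists n g g' (D : seq T), mutually_inverse g g' /\
    forall h h', mutually_inverse h h' -> {in D, h =1 g} ->
    forall F : seq T, exists2 w, C n w & {in F, w =1 h}.
Proof.
move=> cover; apply: contrapT => nC.
pose ok (p : S * S * seq T) := mutually_inverse p.1.1 p.1.2.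
have [step stepP] : {step : nat * (S * S * seq T) -> S * S * seq T &
    forall np, ok np.2 -> [/\ ok (step np),
      {in np.2.2, (step np).1.1 =1 np.2.1.1},
      {subset np.2.2 <= (step np).2},
      forall x, pickle x = np.1 ->
        x \in (step np).2 /\ (step np).1.2 x \in (step np).2 &
      forall w, C np.1 w -> ~ {in (step np).2, w =1 (step np).1.1}]}.
  apply: (@choice _ _ (fun np q => ok np.2 -> [/\ ok q,
      {in np.2.2, q.1.1 =1 np.2.1.1}, {subset np.2.2 <= q.2},
      forall x, pickle x = np.1 -> x \in q.2 /\ q.1.2 x \in q.2 &
      forall w, C np.1 w -> ~ {in q.2, w =1 q.1.1}])).
  move=> [n [[g g'] D]]; rewrite /ok /=.
  have [gg'|ngg'] := pselect (mutually_inverse g g'); last by exists (g, g', D).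
  have [h [h' [F [hh' hg hF]]]] : exists h h' (F : seq T),
      [/\ mutually_inverse h h', {in D, h =1 g} &
        forall w, C n w -> ~ {in F, w =1 h}].
    apply: contrapT => nF; apply: nC; exists n, g, g', D; split => // h h' hh' hg F.
    apply: contrapT => nw; apply: nF; exists h, h', F; split => // w Cw wh.
    by apply: nw; exists w.
  (* Freezing [h] at [x] and at [h' x] determines both the image and the preimage of [x], so the
     limit is bijective. *)
  pose l : seq T := if unpickle n is Some x then [:: x; h' x] else [::].
  exists (h, h', D ++ F ++ l) => _; split => //= [x xD|x xn|w Cw wh].
  - by rewrite mem_cat xD.
  - by rewrite /l -xn pickleK !mem_cat !inE !eqxx !orbT.
  - by apply: (hF w Cw) => x xF; apply: wh; rewrite !mem_cat xF orbT.
pose z := fix z n := if n is m.+1 then step (m, z m) else (1%g, 1%g, [::]).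
have zok n : ok (z n).
  by elim: n => [|n IH]; [split | have [] := stepP (n, z n) IH].
have zsub m n : (m <= n)%N -> {subset (z m).2 <= (z n).2}.
  elim: n => [|n IH]; first by rewrite leqn0 => /eqP ->.
  rewrite leq_eqVlt ltnS => /orP[/eqP->//|/IH mn] x /mn.
  by have [_ _ + _ _] := stepP (n, z n) (zok n); apply.
have zeq m n : (m <= n)%N -> {in (z m).2, (z n).1.1 =1 (z m).1.1}.
  elim: n => [|n IH]; first by rewrite leqn0 => /eqP ->.
  rewrite leq_eqVlt ltnS => /orP[/eqP->//|mn] x xm.
  rewrite -(IH mn x xm).
  by have [_ + _ _ _] := stepP (n, z n) (zok n); apply; exact: (zsub _ _ mn).
pose N (x : T) := (pickle x).+1.
have zx x : x \in (z (N x)).2 /\ (z (N x)).1.2 x \in (z (N x)).2.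
  by have [_ _ _ + _] := stepP (pickle x, z (pickle x)) (zok _); apply.
pose G x := (z (N x)).1.1 x; pose G' x := (z (N x)).1.2 x.
have GE n x : (N x <= n)%N -> (z n).1.1 x = G x.
  by move=> xn; apply: zeq xn _ _; have [] := zx x.
have G'E n x : (N x <= n)%N -> (z n).1.2 x = G' x.
  move=> xn; have /(zeq _ _ xn) := (zx x).2.
  have [_ zK] := zok (N x); have [zK' _] := zok n.
  by rewrite zK => e; rewrite -{1}e zK'.
have Gedge x y : E x y -> E (G x) (G y).
  move=> xy; rewrite -(GE (maxn (N x) (N y))) ?leq_maxl //.
  by rewrite -(GE (maxn (N x) (N y)) y) ?leq_maxr //; exact: (@endo_edge X).
have G'edge x y : E x y -> E (G' x) (G' y).
  move=> xy; rewrite -(G'E (maxn (N x) (N y))) ?leq_maxl //.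
  by rewrite -(G'E (maxn (N x) (N y)) y) ?leq_maxr //; exact: (@endo_edge X).
have GG' : mutually_inverse (@Endo X G Gedge) (@Endo X G' G'edge).
  split=> x /=.
    rewrite -(GE (maxn (N x) (N (G x))) x) ?leq_maxl //.
    rewrite -(G'E (maxn (N x) (N (G x)))); first by have [] := zok (maxn (N x) (N (G x))).
    by rewrite GE ?leq_maxl // leq_maxr.
  rewrite -(G'E (maxn (N x) (N (G' x))) x) ?leq_maxl //.
  rewrite -(GE (maxn (N x) (N (G' x)))); first by have [] := zok (maxn (N x) (N (G' x))).
  by rewrite G'E ?leq_maxl // leq_maxr.
have [n Cn] := cover _ _ GG'.
have [_ _ _ _ /(_ _ Cn)] := stepP (n, z n) (zok n); apply => x xn /=.
rewrite -(GE (maxn (N x) n.+1)) ?leq_maxl //.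
by apply: (zeq n.+1); rewrite ?leq_maxr.
Qed.

Variable sigma : Topological S.
Let TS := Topological.Pack sigma.
Hypothesis sigma_mul : semigroup_topology sigma.

(** Second countability covers the automorphisms by countably many pieces whose quotients lie in
    [V], and some piece is dense near an automorphism [g]. Taking [w1] near [h * g] and [w2] near
    [g] in this piece, the product of [w1] and the inverse of [w2] is in [V] and near [h]. *)
Lemma automorphisms_nearly_open (B : nat -> set S) (V : set S) :
  (forall n, @open TS (B n)) ->
  (forall U s, @open TS U -> U s -> exists2 n, B n s & B n `<=` U) ->
  @open TS V -> V 1%g ->
  exists D : seq T, forall h h', mutually_inverse h h' ->
    {in D, forall x, h x = x} -> forall F : seq T, exists2 w, V w & {in F, w =1 h}.
Proof.
move=> oB Bbase oV V1.
have [V1' [V2' [oV1' oV2' V11 V21 V12]]] :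
    exists V1 V2 : set TS, [/\ open V1, open V2, V1 1%g, V2 1%g &
    forall a b : S, V1 a -> V2 b -> V (a * b)%g].
  by apply: (semigroup_topology_open sigma_mul oV); rewrite mulg1.
(* The piece given by [i] and [j] lies in a translate by [a] of a small neighbourhood of [1]. The
   element [a] cancels when one member is multiplied by the inverse of another. *)
pose good i j a a' := mutually_inverse a a' /\ forall h h', mutually_inverse h h' ->
  B i h -> B j h' -> V1' (h * a')%g /\ V2' (a * h')%g.
pose C n : set S := [set h | exists i j, [/\ n = pickle (i, j),
  exists a a', good i j a a' & exists h', [/\ mutually_inverse h h', B i h & B j h']]].
have [n [g [g' [D [gg' gD]]]]] : exists n g g' (D : seq T), mutually_inverse g g' /\
    forall h h', mutually_inverse h h' -> {in D, h =1 g} ->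
    forall F : seq T, exists2 w, C n w & {in F, w =1 h}.
  apply: automorphisms_baire => h h' hh'.
  have [hV h'V] := mutually_inverse_mulV hh'.
  have [W1 [W1' [oW1 _ W1h W1'h' W1V]]] : exists W W' : set TS,
      [/\ open W, open W', W h, W' h' & forall a b : S, W a -> W' b -> V1' (a * b)%g].
    by apply: (semigroup_topology_open sigma_mul oV1'); rewrite hV.
  have [W2 [W2' [_ oW2' W2h W2'h' W2V]]] : exists W W' : set TS,
      [/\ open W, open W', W h, W' h' & forall a b : S, W a -> W' b -> V2' (a * b)%g].
    by apply: (semigroup_topology_open sigma_mul oV2'); rewrite hV.
  have [i Bih BiW] := Bbase _ _ oW1 W1h.
  have [j Bjh' BjW] := Bbase _ _ oW2' W2'h'.
  exists (pickle (i, j)), i, j; split => //; last by exists h'.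
  exists h, h'; split => // k k' kk' /BiW W1k /BjW W2k'.
  by split; [exact: W1V | exact: W2V].
exists D => h h' hh' hD F.
have [|w1 [i [j [nij [a [a' [aa' aV]]] [w1' [ww1 Bi1 Bj1]]]]] w1h] :=
    gD (h * g)%g (g' * h')%g (mutually_inverse_mul hh' gg') _ F.
  by move=> x xD /=; rewrite hD.
have [//|w2 [i2 [j2 [nij2 _ [w2' [ww2 Bi2 Bj2]]]]] w2g] := gD g g' gg' _ (map h F).
have [ii2 jj2] : i = i2 /\ j = j2.
  by have /(pcan_inj pickleK) [] : pickle (i, j) = pickle (i2, j2) by rewrite -nij.
rewrite -{}ii2 -{}jj2 in Bi2 Bj2.
have [V1w _] := aV _ _ ww1 Bi1 Bj1.
have [_ V2w] := aV _ _ ww2 Bi2 Bj2.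
exists (w1 * w2')%g.
  have := V12 _ _ V1w V2w.
  rewrite mulgA -(mulgA w1 a' a) (mutually_inverse_mulV aa').2 mulg1; exact.
move=> x xF /=; rewrite w1h //=.
by rewrite -[g (h x)]w2g ?map_f //; have [] := ww2.
Qed.

End Criterion.

(* The map [f |-> f * h * g] sends neighbourhoods of [1] in the automorphism
   group to sets that are dense in a neighbourhood of [s = f * g]. *)
Definition automorphism_approximable (T : countType) (E : T -> T -> Prop) : Prop :=
  forall s : endo (@Structure T E), exists f g : endo (@Structure T E),
    (forall x, g (f x) = s x) /\
    forall D : seq T, exists D' : seq T,
      forall s' : endo (@Structure T E), {in D', s' =1 s} ->
      forall F : seq T, exists h h' : endo (@Structure T E),
        [/\ mutually_inverse h h', {in D, forall x, h x = x} &
          {in F, forall x, g (h (f x)) = s' x}].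

Theorem pointwise_unique_polish_criterion (R : realType) (T : countType)
    (E : T -> T -> Prop) (X := @Structure T E) :
  (forall x y : T, zariski_open [set f : endo X | f x = y]) ->
  automorphism_approximable E -> pointwise_unique_polish R X.
Proof.
move=> zar apx; split; first exact: pointwise_polish_semigroup_topology.
move=> sigma [[sep cm] mul]; pose TS := Topological.Pack sigma.
have [d [cd d0]] := completely_metrizable_distance cm.
have hT : hausdorff_space TS := completely_metrizable_hausdorff cm.
have ptw : forall U : set (endo X), open U -> @open TS U.
  move=> U; rewrite openE => oU; rewrite openE => s /oU /nbhs_pointwise[D DU].
  suff : @nbhs _ TS s [set s' : endo X | {in D, s' =1 s}] by apply: filterS.
  elim: D {DU} => [|x D IH].
    by apply: filterS filterT => f _ y; rewrite in_nil.
  have xs : @nbhs _ TS s [set f : endo X | f x = s x].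
    apply: (@open_nbhs_nbhs TS); split=> //.
    exact: (zariski_open_open mul hT (zar x (s x))).
  apply: filterS (filterI xs IH) => f [/= fx fD] z; rewrite inE => /orP[/eqP->//|].
  exact: fD.
have dxx x : d x x = 0 by apply/d0.
have [B [oB Bbase]] := separable_second_countable cd dxx sep.
apply/seteqP; split; last exact: ptw.
apply: (weston cm) => //.
  by have [[_ cmp] _] := pointwise_polish_semigroup_topology R E;
    exact: completely_metrizable_hausdorff cmp.
move=> U s oU Us; apply/nbhs_pointwise.
have [f [g [fgs fgP]]] := apx s.
have fgE : (f * 1 * g)%g = s by apply: endo_ext => x /=; exact: fgs.
(* Two uses of continuity give [V4] around [1] with [f * w * g] in [U] for every [w] in [V4]. *)
have [V1 [V2 [oV1 oV2 V1f V2g V12]]] : exists V1 V2 : set TS,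
    [/\ open V1, open V2, V1 (f * 1)%g, V2 g & forall a b : endo X, V1 a -> V2 b -> U (a * b)%g].
  by apply: (semigroup_topology_open mul oU); rewrite fgE.
have [V3 [V4 [oV3 oV4 V3f V41 V34]]] := semigroup_topology_open mul oV1 V1f.
have [D Dh] := automorphisms_nearly_open mul oB Bbase oV4 V41.
have [D' D's] := fgP D.
exists D' => s' s's A /nbhs_pointwise[F FA].
have [h [h' [hh' hD hF]]] := D's s' s's F.
have [w Vw wh] := Dh h h' hh' hD (map f F).
exists (f * w * g)%g; split; first by apply: V12 => //; exact: V34.
by apply: FA => x xF /=; rewrite wh ?map_f // hF.
Qed.

(** * Disjoint unions of complete graphs *)

Section Transposition.
Variable A : eqType.
Implicit Types p q x : A.

Definition transposition p q x := if x == p then q else if x == q then p else x.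

Lemma transpositionL p q : transposition p q p = q.
Proof. by rewrite /transposition eqxx. Qed.

Lemma transpositionD p q x : x != p -> x != q -> transposition p q x = x.
Proof. by rewrite /transposition => /negbTE -> /negbTE ->. Qed.

Lemma transpositionK p q : involutive (transposition p q).
Proof.
move=> x; rewrite /transposition.
have [->|xp] := eqVneq x p; first by rewrite eqxx; case: eqVneq.
have [->|xq] := eqVneq x q; first by rewrite eqxx.
by rewrite (negbTE xp) (negbTE xq).
Qed.

Lemma exists_fresh (u : nat -> A) (l : seq A) : injective u ->
  exists r, u r \notin l.
Proof.
move=> uI; apply: contrapT => /forallNP ul.
have sub : {subset map u (iota 0 (size l).+1) <= l}.
  by move=> x /mapP[r _ ->]; apply/negPn/negP/ul.
have := uniq_leq_size _ sub.
by rewrite map_inj_uniq ?iota_uniq // size_map size_iota ltnn => /(_ isT).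
Qed.

End Transposition.

(** * Infinitely many classes of finite size, with or without loops *)

Section FiniteClasses.
Variables (n : nat) (loops : bool) (E : nat * 'I_n -> nat * 'I_n -> Prop).
Hypothesis EE : forall x y, E x y <-> x.1 = y.1 /\ (loops \/ x.2 <> y.2).
Notation T := (nat * 'I_n)%type.
Notation X := (@Structure T E).
Implicit Types (x y : T).

Let endo_class (f : endo X) x y : x.1 = y.1 -> (f x).1 = (f y).1.
Proof.
move=> xy; have [->//|nxy] := eqVneq x y.
have : edge (f x) (f y).
  apply: endo_edge; apply/EE; split => //; right => xy2.
  by case/eqP: nxy; apply/eqP; rewrite -pair_eqE /= xy xy2 /pair_eq /= !eqxx.
by move=> /EE[].
Qed.

(** The maps that an endomorphism may induce between two classes. *)
Let good (s : 'I_n -> 'I_n) := loops \/ injective s.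

Let good_endo (f : endo X) i : good (fun j => (f (i, j)).2).
Proof.
have [l|nl] := pselect loops; [by left | right => j j' jj'].
apply: contrapT => njj'.
have /EE[_ []//] : E (f (i, j)) (f (i, j')).
by apply: (@endo_edge X); apply/EE; split => //; right.
Qed.

Let mk_endo (c : nat -> nat) (s : nat -> 'I_n -> 'I_n) :
  (forall i, good (s i)) -> {f : endo X | forall x, f x = (c x.1, s x.1 x.2)}.
Proof.
move=> gs; have cs x y : E x y -> E (c x.1, s x.1 x.2) (c y.1, s y.1 y.2).
  move=> /EE[xy xy2]; apply/EE; split => /=; first by rewrite xy.
  have [l|si] := gs x.1; [by left | case: xy2 => [|nxy]; first by left].
  by right; rewrite -xy => /si.
by exists (@Endo X _ cs).
Qed.

(** Here [a] sends every class to class [i], and [c] moves only class [k], so [U] says that [f] maps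
    class [i] into class [k]. Finitely many restrictions to class [i] remain, and those that do not
    send [j] to [l] are excluded by inequations with a constant side. *)
Lemma zariski_open_finite_classes x y : zariski_open [set f : endo X | f x = y].
Proof.
case: x y => i j [k l].
have gid : forall i : nat, good (fun j => j) by move=> ?; right.
have [a aE] := mk_endo (fun _ => i) gid.
have [c cE] := mk_endo (fun m => if m == k then k.+1 else m) gid.
pose U := [set f : endo X | (a * f * 1)%g <> (a * f * c)%g].
(* Quantifying over [g] makes [P s] hold trivially when no endomorphism induces [s]. *)
pose P (s : {ffun 'I_n -> 'I_n}) :=
  [set f : endo X | forall g : endo X, (forall x, g x = (k, s x.2)) -> (a * f)%g <> g].
have zP (r : seq {ffun 'I_n -> 'I_n}) : zariski_open (U `&` [set f | forall s, s \in r -> P s f]).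
  elim: r => [|s r IH].
    rewrite (_ : _ `&` _ = U); first exact: zariski_neq.
    by apply/seteqP; split => [f []|f Uf].
  have [[g gs]|ng] := pselect (exists g : endo X, forall x, g x = (k, s x.2)).
    rewrite (_ : _ `&` _ = U `&` [set f | forall s, s \in r -> P s f] `&`
       [set f : endo X | (a * f)%g <> g]).
      by apply: zariski_setI => //; exact: zariski_neq_cst.
    apply/seteqP; split => f /=.
      move=> [Uf Pf]; split; last by apply: (Pf s) => //; exact: mem_head.
      by split => // s' s'r; apply: Pf; rewrite inE s'r orbT.
    move=> [[Uf Pf] afg]; split => // s'; rewrite inE => /orP[/eqP->|/Pf//] g' g's.
    by rewrite (_ : g' = g) //; apply: endo_ext => z; rewrite gs g's.
  rewrite (_ : _ `&` _ = U `&` [set f | forall s, s \in r -> P s f]) //.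
  apply/seteqP; split => f [Uf Pf]; split => // s'.
    by move=> s'r; apply: Pf; rewrite inE s'r orbT.
  by rewrite inE => /orP[/eqP-> g gs|/Pf//]; case: ng; exists g.
rewrite (_ : [set _ | _] = U `&` [set f | forall s, 
  s \in [seq s : {ffun 'I_n -> 'I_n} <- enum {ffun 'I_n -> 'I_n} | s j != l] -> P s f]) //.
have UP f : U f <-> (f (i, j)).1 = k.
  split=> [Uf|fk].
    apply: contrapT => nfk; apply: Uf; apply: endo_ext => z /=.
    rewrite cE aE -(endo_class f (_ : (i, j).1 = (i, z.2).1)) //.
    by move/eqP/negbTE: nfk => ->; rewrite [LHS]surjective_pairing -(endo_class f (_ : (i, j).1 = (i, z.2).1)).
  move=> /(congr1 (fun f : endo X => (f (i, j)).1)) /=.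
  by rewrite cE aE /= fk eqxx => /eqP; rewrite ltn_eqF.
apply/seteqP; split => f /=.
  move=> fij; split; first by apply/UP; rewrite fij.
  move=> s; rewrite mem_filter => /andP[sjl _] g gs /(congr1 (fun f : endo X => f (i, j))) /=.
  by rewrite aE /= fij gs => -[] lsj; rewrite lsj eqxx in sjl.
move=> [/UP fk Pf]; apply: contrapT => nf.
have nj : (f (i, j)).2 != l by apply/eqP => fl; apply: nf; rewrite [LHS]surjective_pairing fk fl.
have [g gE] := mk_endo (fun _ => k) (fun _ => good_endo f i).
apply: (Pf [ffun j => (f (i, j)).2] _ g).
- by rewrite mem_filter ffunE nj mem_enum.
- by move=> z; rewrite gE ffunE.
- apply: endo_ext => z /=; rewrite gE aE [LHS]surjective_pairing.
  by rewrite -(endo_class f (_ : (i, j).1 = (i, z.2).1)) ?fk.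
Qed.

(** [f] uses the classes coded by [inl i]. For good [t], the classes coded by [inr (k, t, r)], with
    [r] arbitrary, are all sent by [g] to class [k] through [t]. A permutation of classes can thus
    give [f * h * g] any admissible values. *)
Lemma automorphism_approximable_finite_classes : automorphism_approximable E.
Proof.
move=> s.
pose code := (nat + nat * {ffun 'I_n -> 'I_n} * nat)%type.
pose ci i : nat := pickle (inl i : code).
have ciI : injective ci by move=> i i' /(pcan_inj pickleK) [].
have gid (i : nat) : good (fun j => j) by right.
have [f fE] := mk_endo ci gid.
(* The class of [s (i, j)] is independent of [j]; the default [0] serves the case [n = 0], where no
   [j] exists. *)
pose gc c : nat := match unpickle c : option code with
  | Some (inl i) => if pselect (exists j : 'I_n, True) is left h then (s (i, projT1 (cid h))).1 else 0%N
  | Some (inr (k, _, _)) => k | None => 0%N end.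
pose gs c : 'I_n -> 'I_n := match unpickle c : option code with
  | Some (inl i) => fun j => (s (i, j)).2
  | Some (inr (_, t, _)) => fun j => if `[< good t >] then t j else j
  | None => id end.
have ggs c : good (gs c).
  rewrite /gs; case: unpickle => [w|]; last exact: (gid 0%N).
  case: w => [i|[[k t] r]]; first exact: (good_endo s i).
  by case: asboolP => // _; exact: (gid 0%N).
have [g gE] := mk_endo gc ggs.
have gci i j : g (ci i, j) = s (i, j).
  rewrite gE /gc /gs /= pickleK; case: pselect => [h|[]]; last by exists j.
  by rewrite [RHS]surjective_pairing (endo_class s (_ : _ = (i, j).1)).
exists f, g; split => [[i j]|D]; first by rewrite fE gci.
(* All points of the classes whose image under [f] meets [D]: there [h] has to be the identity on
   classes, so [s'] must equal [s]. *)
exists (flatten [seq if (unpickle d.1 : option code) is Some (inl i) then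
   [seq (i, j) | j <- enum 'I_n] else [::] | d : T <- D]) => s' s's F.
have D's i j : ci i \in map fst D -> s' (i, j) = s (i, j).
  move=> /mapP[d dD ciE]; apply: s's; apply/flattenP.
  exists [seq (i, j) | j <- enum 'I_n]; last by rewrite map_f ?mem_enum.
  by apply/mapP; exists d; rewrite // -ciE pickleK.
suff [t [t' [tK t'K tD tF]]] : exists t t' : nat -> nat, [/\ cancel t t', cancel t' t,
    {in D, forall d, t d.1 = d.1} &
    {in map fst F, forall i j, g (t (ci i), j) = s' (i, j)}].
  have [h hE] := mk_endo t gid; have [h' h'E] := mk_endo t' gid.
  exists h, h'; split.
  - by split=> z /=; rewrite !(h'E, hE) /= ?tK ?t'K -surjective_pairing.
  - by move=> d dD; rewrite hE tD // -surjective_pairing.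
  - by case=> i j ijF; rewrite fE hE tF //; apply/mapP; exists (i, j).
elim: (map fst F) => [|i r [t [t' [tK t'K tD tF]]]]; first by exists id, id.
have [ciD|nciD] := boolP (ci i \in map fst D).
  exists t, t'; split => // i'; rewrite inE => /orP[/eqP->|/tF//] j.
  have -> : t (ci i) = ci i by have /mapP[d dD ->] := ciD; exact: tD.
  by rewrite D's.
have [ir|nir] := boolP (i \in r).
  by exists t, t'; split => // i'; rewrite inE => /orP[/eqP->|]; exact: tF.
pose p := t (ci i); pose st := [ffun j => (s' (i, j)).2].
pose k := if pselect (exists j : 'I_n, True) is left h then (s' (i, projT1 (cid h))).1 else 0%N.
(* The class of [f] at [i] is redirected to a fresh class [q] on which [g] acts as [s'] does on
   class [i]; the transposition disturbs neither [D] nor the classes already treated. *)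
have [m mf] := @exists_fresh _ (fun m => pickle (inr (k, st, m) : code))
   (map fst D ++ [seq t (ci i) | i <- r]) ltac:(by move=> m m' /(pcan_inj pickleK) []).
set q := pickle _ in mf.
rewrite mem_cat negb_or in mf; have /andP[qD qr] := mf.
have pD : p \notin map fst D.
  apply: contra nciD => /mapP[d dD pd]; apply/mapP; exists d => //.
  by rewrite -(tK d.1) tD // -pd /p tK.
exists (transposition p q \o t), (t' \o transposition p q); split.
- by move=> z /=; rewrite transpositionK tK.
- by move=> z /=; rewrite t'K transpositionK.
- move=> d dD /=; rewrite tD // transpositionD //.
  + by apply: contraNneq pD => <-; exact: map_f.
  + by apply: contraNneq qD => <-; exact: map_f.
move=> i'; rewrite inE => /orP[/eqP->|i'r] j /=.
  rewrite -/p transpositionL gE /gc /gs /q pickleK /= asboolT.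
    rewrite ffunE [RHS]surjective_pairing; congr (_, _).
    rewrite /k; case: pselect => [h|[]]; last by exists j.
    exact: endo_class.
  by have := good_endo s' i; rewrite /good => -[|sI]; [left | right => ? ?; rewrite !ffunE; exact: sI].
rewrite transpositionD ?tF //.
- by apply: contraNneq nir => /(can_inj tK)/ciI <-.
- by apply: contraNneq qr => <-; apply/mapP; exists i'.
Qed.

End FiniteClasses.

(** * Equivalence relations with infinite classes *)

Section InfiniteClasses.
Variables (I : countType) (E : I * nat -> I * nat -> Prop).
Hypothesis EE : forall x y, E x y <-> x.1 = y.1.
Notation T := (I * nat)%type.
Notation X := (@Structure T E).
Implicit Types (x y : T).

Let endo_class (f : endo X) x y : x.1 = y.1 -> (f x).1 = (f y).1.
Proof. by move=> xy; apply/EE; apply: (@endo_edge X); apply/EE. Qed.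

Let mk_endo (F : T -> T) : (forall x y, x.1 = y.1 -> (F x).1 = (F y).1) ->
  {f : endo X | forall x, f x = F x}.
Proof.
move=> FE; have F_edge x y : E x y -> E (F x) (F y) by move=> /EE xy; exact/EE/FE.
by exists (@Endo X F F_edge).
Qed.

(** With loops the constant map [a] at [x] is an endomorphism, and [c] moves only [y], within its
    class: a single inequation says that [f x = y]. *)
Lemma zariski_open_infinite_classes x y : zariski_open [set f : endo X | f x = y].
Proof.
have [a aE] := mk_endo (fun _ _ _ => erefl : (x).1 = x.1).
have [c cE] : {c : endo X | forall z, c z = if z == y then (y.1, y.2.+1) else z}.
  apply: mk_endo => z t zt.
  by have [zy|_] := eqVneq z y; have [ty|_] := eqVneq t y; rewrite /= -?zy -?ty.
rewrite (_ : [set _ | _] = [set f : endo X | (a * f * 1)%g <> (a * f * c)%g]).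
  exact: zariski_neq.
apply/seteqP; split=> f /=.
  move=> fxy /(congr1 (fun f : endo X => (f x).2)) /=.
  by rewrite cE aE fxy eqxx => /eqP /=; rewrite ltn_eqF.
move=> nac; apply: contrapT => nfxy; apply: nac; apply: endo_ext => z /=.
by rewrite cE aE; case: eqP.
Qed.

(** [c] and [k] are the actions of [f] and [g] on classes. Either each value of [k] recurs outside
    any finite set, so that classes can be redirected, or there are finitely many classes and every
    [s'] close to [s] acts on them as [s] does. *)
Lemma automorphism_approximable_infinite_classes :
  (forall phi : I -> I, exists c k : I -> I,
     [/\ injective c, forall i, k (c i) = phi i &
       (forall m (l : seq I), exists2 q, q \notin l & k q = m) \/
       (exists l : seq I, forall i, i \in l)]) ->
  automorphism_approximable E.
Proof.
move=> H s.
have [ci [k [ciI kci Hk]]] := H (fun i => (s (i, 0%N)).1).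
(* Within a class, [inl j] marks the points used by [f], and [inr (l, r)] marks infinitely many
   points that [g] sends to position [l]. *)
pose code := (nat + nat * nat)%type.
pose f0 x := (ci x.1, pickle (inl x.2 : code)).
have f0I : injective f0.
  by move=> [i j] [i' j'] [/ciI ->] /(pcan_inj pickleK) [->].
have [f fE] : {f : endo X | forall x, f x = f0 x}.
  by apply: mk_endo => x y xy; rewrite /= xy.
pose dec c := if pselect (exists i, ci i = c) is left h then Some (projT1 (cid h)) else None.
have decK i : dec (ci i) = Some i.
  rewrite /dec; case: pselect => [h|[]]; last by exists i.
  by case: (cid h) => i' /= /ciI ->.
have decP c i : dec c = Some i -> ci i = c.
  by rewrite /dec; case: pselect => // h [<-]; case: (cid h).
pose g0 x : T := match unpickle x.2 : option code with
  | Some (inl j) => if dec x.1 is Some i then s (i, j) else (k x.1, j)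
  | Some (inr (l, _)) => (k x.1, l) | None => (k x.1, 0%N) end.
have g0k x : (g0 x).1 = k x.1.
  rewrite /g0; case: unpickle => [[j|[l r]]|] //.
  case decx: (dec x.1) => [i|] //; have <- := decP _ _ decx; rewrite kci.
  exact: endo_class.
have [g gE] : {g : endo X | forall x, g x = g0 x}.
  by apply: mk_endo => x y xy; rewrite !g0k xy.
have gf x : g (f x) = s x by rewrite gE fE /g0 /= pickleK decK -surjective_pairing.
exists f, g; split => // D0.
(* If there are finitely many classes, [D] is enlarged to meet the image of each. *)
have [D [D0D DI]] : exists D : seq T, {subset D0 <= D} /\
    ((forall i, ci i \in map fst D) \/
     (forall m (l : seq I), exists2 q, q \notin l & k q = m)).
  case: Hk => [|[l lI]]; first by exists D0; split => //; right.
  exists (D0 ++ [seq (ci i, 0%N) | i <- l]); split=> [x xD|].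
    by rewrite mem_cat xD.
  left => i; apply/mapP; exists (ci i, 0%N) => //.
  by rewrite mem_cat; apply/orP; right; apply/mapP; exists i.
exists (flatten [seq if dec d.1 is Some i then
   (i, 0%N) :: (if (unpickle d.2 : option code) is Some (inl j) then [:: (i, j)] else [::])
   else [::] | d : T <- D]) => s' s's F.
have D's1 i : ci i \in map fst D -> s' (i, 0%N) = s (i, 0%N).
  move=> /mapP[d dD ciE]; apply: s's; apply/flattenP; eexists.
    by apply/mapP; exists d.
  by rewrite -ciE decK mem_head.
have D's x : f x \in D -> s' x = s x.
  move=> fxD; apply: s's; apply/flattenP; eexists.
    by apply/mapP; exists (f x).
  by rewrite fE /= decK pickleK -surjective_pairing !inE eqxx orbT.
suff [h [h' [[hK h'K] hD hF]]] : exists h h' : endo X, [/\ mutually_inverse h h',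
    {in D, forall x, h x = x} & {in F, forall x, g (h (f x)) = s' x}].
  by exists h, h'; split=> // x /D0D; exact: hD.
elim: F => [|x F [h [h' [[hK h'K] hD hF]]]]; first by exists 1%g, 1%g.
have [xF|xF] := boolP (x \in F).
  by exists h, h'; split => // y; rewrite inE => /orP[/eqP->|]; exact: hF.
have [fxD|fxD] := boolP (f x \in D).
  exists h, h'; split => // y; rewrite inE => /orP[/eqP->|]; last exact: hF.
  by rewrite hD // D's.
have hI := can_inj hK.
have same_class y z : (h y).1 = (h z).1 -> y.1 = z.1.
  by move=> /(endo_class h'); rewrite !hK.
have fst_f i y : ci i = (f y).1 -> i = y.1 by rewrite fE => /ciI.
have [h1 [h1' [[h1K h1'K] h1D h1F h1x]]] : exists h1 h1' : endo X,
    [/\ mutually_inverse h1 h1', {in D, forall x, h1 x = x},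
      {in F, forall x, g (h1 (f x)) = s' x} & k (h1 (f x)).1 = (s' x).1].
  have [/mapP[d dD cid]|nD] := boolP (ci x.1 \in map fst D).
    exists h, h'; split => //.
    rewrite (endo_class h (_ : (f x).1 = d.1)) ?fE // hD // -cid kci.
    by rewrite (endo_class s' (_ : x.1 = (x.1, 0%N).1)) // D's1 //; apply/mapP; exists d.
  have [/mapP[y yF xy]|nF] := boolP (x.1 \in map fst F).
    exists h, h'; split => //; rewrite (endo_class s' xy) -hF // gE g0k.
    by congr k; apply: endo_class; rewrite !fE /= xy.
  case: DI => [DI|/(_ (s' x).1 (map fst D ++ [seq (h (f y)).1 | y <- F]))[q]].
    by rewrite DI in nD.
  rewrite mem_cat negb_or => /andP[qD qF] kq.
  pose p := (h (f x)).1.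
  have [t tE] : {t : endo X | forall y, t y = (transposition p q y.1, y.2)}.
    by apply: mk_endo => y z /= ->.
  have tK : cancel t t by move=> y; rewrite !tE /= transpositionK -surjective_pairing.
  have tid y : y.1 != p -> y.1 != q -> t y = y.
    by move=> yp yq; rewrite tE transpositionD // -surjective_pairing.
  exists (h * t)%g, (t * h')%g; split.
  - exact: mutually_inverse_mul.
  - move=> y yD /=; rewrite hD // tid //.
      apply: contraNneq nD; rewrite -{1}(hD y yD) => /same_class; rewrite fE /= => <-.
      exact: map_f.
    by apply: contraNneq qD => <-; exact: map_f.
  - move=> y yF /=; rewrite tid ?hF //.
      apply: contraNneq nF => /same_class; rewrite !fE /= => /ciI <-.
      exact: map_f.
    by apply: contraNneq qF => <-; apply/mapP; exists y.
  - by rewrite /= tE /= -/p transpositionL.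
have h1I := can_inj h1K.
pose p := h1 (f x).
(* Then the point is corrected within its class, by a swap with a fresh point that [g] sends to
   [s' x]. *)
have [r] := @exists_fresh _ (fun r => (p.1, pickle (inr ((s' x).2, r) : code)))
   (D ++ [seq h1 (f y) | y <- F]) ltac:(by move=> m m' /(congr1 snd)/(pcan_inj pickleK) []).
set q := (p.1, _); rewrite mem_cat negb_or => /andP[qD qF].
have [t tE] : {t : endo X | forall y, t y = transposition p q y}.
  by apply: mk_endo => y z yz; rewrite /transposition; do ![case: eqP => [?|_]]; subst.
have tK : cancel t t by move=> y; rewrite !tE transpositionK.
exists (h1 * t)%g, (t * h1')%g; split.
- exact: mutually_inverse_mul.
- move=> y yD /=; rewrite h1D // tE transpositionD //.
    by apply: contraNneq fxD; rewrite -{1}(h1D y yD) => /h1I <-.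
  by apply: contraNneq qD => <-.
- move=> y; rewrite inE => /orP[/eqP->|yF] /=; rewrite tE.
    rewrite transpositionL gE /g0 /= pickleK.
    by rewrite [RHS]surjective_pairing -h1x.
  rewrite transpositionD ?h1F //.
    by apply: contraNneq xF => /h1I; rewrite !fE => /f0I <-.
  by apply: contraNneq qF => <-; apply/mapP; exists y.
Qed.

End InfiniteClasses.

Lemma structure_iff (A : Type) (E E' : A -> A -> Prop) :
  (forall x y, E x y <-> E' x y) -> @Structure A E = @Structure A E'.
Proof. by move=> EE'; congr Structure; apply/funext => x; apply/funext => y; exact/propext. Qed.

Theorem unique_polish_finite_classes (R : realType) (n : nat) :
  pointwise_unique_polish R (disjoint_copies nat (complete_graph 'I_n)) /\
  pointwise_unique_polish R (with_loops (disjoint_copies nat (complete_graph 'I_n))).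
Proof.
split.
  have EE (x y : nat * 'I_n) : x.1 = y.1 /\ x.2 <> y.2 <-> x.1 = y.1 /\ (false \/ x.2 <> y.2).
    by split=> -[xy xy2]; split=> //; [right | case: xy2].
  apply: (@pointwise_unique_polish_criterion R (nat * 'I_n)%type
    (fun x y => x.1 = y.1 /\ x.2 <> y.2)).
    exact: zariski_open_finite_classes EE.
  exact: automorphism_approximable_finite_classes EE.
have EE (x y : nat * 'I_n) : (x.1 = y.1 /\ x.2 <> y.2) \/ x = y <->
    x.1 = y.1 /\ (true \/ x.2 <> y.2).
  split=> [[[]|->]|[xy _]]; try by split => //; left.
  have [xy2|] := pselect (x.2 = y.2); last by left.
  by right; rewrite [LHS]surjective_pairing xy xy2 -surjective_pairing.
apply: (@pointwise_unique_polish_criterion R (nat * 'I_n)%type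
  (fun x y => (x.1 = y.1 /\ x.2 <> y.2) \/ x = y)).
  exact: zariski_open_finite_classes EE.
exact: automorphism_approximable_finite_classes EE.
Qed.

Lemma unique_polish_infinite_classes (R : realType) (I : countType) :
  (forall phi : I -> I, exists c k : I -> I,
     [/\ injective c, forall i, k (c i) = phi i &
       (forall m (l : seq I), exists2 q, q \notin l & k q = m) \/
       (exists l : seq I, forall i, i \in l)]) ->
  pointwise_unique_polish R (with_loops (disjoint_copies I (complete_graph nat))).
Proof.
move=> H; have EE (x y : I * nat) :
    (x.1 = y.1 /\ x.2 <> y.2) \/ x = y <-> x.1 = y.1.
  split=> [[[]|->]|xy] //.
  have [xy2|] := pselect (x.2 = y.2); last by left.
  by right; rewrite [LHS]surjective_pairing xy xy2 -surjective_pairing.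
apply: (@pointwise_unique_polish_criterion R (I * nat)%type
  (fun x y => (x.1 = y.1 /\ x.2 <> y.2) \/ x = y)).
  exact: zariski_open_infinite_classes EE.
exact: automorphism_approximable_infinite_classes EE H.
Qed.

Theorem unique_polish_finitely_many_infinite_classes (R : realType) (n : nat) :
  pointwise_unique_polish R (with_loops (disjoint_copies 'I_n (complete_graph nat))).
Proof.
apply: unique_polish_infinite_classes => phi; exists id, phi; split => //.
by right; exists (enum 'I_n) => i; rewrite mem_enum.
Qed.

Theorem unique_polish_infinitely_many_infinite_classes (R : realType) :
  pointwise_unique_polish R (with_loops (disjoint_copies nat (complete_graph nat))).
Proof.
apply: unique_polish_infinite_classes => phi.
pose code := (nat + nat * nat)%type.
exists (fun i => pickle (inl i : code)), (fun c => match unpickle c : option code with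
  | Some (inl i) => phi i | Some (inr (m, _)) => m | None => 0%N end); split.
- by move=> i j /(pcan_inj pickleK) [].
- by move=> i; rewrite pickleK.
- left=> m l; have [r rl] := @exists_fresh _ (fun r => pickle (inr (m, r) : code)) l
    ltac:(by move=> r r' /(pcan_inj pickleK) []).
  by exists (pickle (inr (m, r) : code)); rewrite // pickleK.
Qed.

(** * Extension properties and back-and-forth *)

Section RelationClass.
Variables sym tr : bool.

(* [sym, tr = true, false], [false, false] and [false, true] give the classes of
   simple graphs, directed graphs and strict partial orders. *)
Definition relation_class (A : Type) (r : A -> A -> Prop) : Prop :=
  [/\ forall x, ~ r x x, sym -> forall x y, r x y -> r y x &
    tr -> forall x y z, r x y -> r y z -> r x z].

(* [L] and [U] are the sets of p in P with [r p v] and [r v p], for a new point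
   v such that P with v is again in the class. *)
Definition one_point_type (A : eqType) (r : A -> A -> Prop) (P : seq A)
    (L U : A -> Prop) : Prop :=
  (sym -> {in P, forall p, L p <-> U p}) /\
  (tr -> [/\ {in P &, forall p q, r p q -> L q -> L p},
             {in P &, forall p q, r p q -> U p -> U q} &
             {in P &, forall p q, L p -> U q -> r p q}]).

Definition realizes (A : eqType) (r : A -> A -> Prop) (P : seq A)
    (L U : A -> Prop) (v : A) : Prop :=
  v \notin P /\ {in P, forall p, (r p v <-> L p) /\ (r v p <-> U p)}.

(** Among countable relations in the class, this determines the relation up to isomorphism, by
    [back_and_forth]. *)
Definition extension_property (A : eqType) (r : A -> A -> Prop) : Prop :=
  forall P L U, one_point_type r P L U -> exists v, realizes r P L U v.

Definition partial_isomorphism (A B : eqType) (r : A -> A -> Prop)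
    (r' : B -> B -> Prop) (l : seq (A * B)) : Prop :=
  {in l &, forall p q, (p.1 = q.1 <-> p.2 = q.2) /\ (r p.1 q.1 <-> r' p.2 q.2)}.

Lemma partial_isomorphism_sym (A B : eqType) (r : A -> A -> Prop)
    (r' : B -> B -> Prop) (l : seq (A * B)) : partial_isomorphism r r' l ->
  partial_isomorphism r' r [seq (p.2, p.1) | p <- l].
Proof.
by move=> rl _ _ /mapP[p pl ->] /mapP[q ql ->] /=; have [-> ->] := rl p q pl ql.
Qed.

Section PartialIsomorphism.
Variables (A B : eqType) (r : A -> A -> Prop) (r' : B -> B -> Prop).
Hypotheses (rC : relation_class r) (r'C : relation_class r').
Variables (l : seq (A * B)) (a : A).
Hypothesis rl : partial_isomorphism r r' l.

(** With [image_above], the type of [a] over the domain of [l], transported to the range; a point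
    realizing it is a possible image of [a]. *)
Definition image_below q := exists2 p, p \in l & p.2 = q /\ r p.1 a.
Definition image_above q := exists2 p, p \in l & p.2 = q /\ r a p.1.

Lemma image_one_point_type :
  one_point_type r' (map snd l) image_below image_above.
Proof.
have [_ rS rT] := rC; split=> [sy q _|/rT{}rT].
  by split=> -[p pl [pq /(rS sy) pa]]; exists p.
split=> _ _ /mapP[p1 p1l ->] /mapP[p2 p2l ->].
- move=> /(rl p1l p2l).2 p12 [p pl [/(rl pl p2l).1 pp2 pa]].
  by exists p1 => //; split => //; apply: rT p12 _; rewrite -pp2.
- move=> /(rl p1l p2l).2 p12 [p pl [/(rl pl p1l).1 pp1 pa]].
  by exists p2 => //; split => //; apply: rT p12; rewrite -pp1.
- move=> [p pl [/(rl pl p1l).1 pp1 pa]] [q ql [/(rl ql p2l).1 qp2 qa]].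
  by apply/(rl p1l p2l).2; rewrite -pp1 -qp2; exact: rT pa qa.
Qed.

Lemma partial_isomorphism_cons b : a \notin map fst l ->
  realizes r' (map snd l) image_below image_above b ->
  partial_isomorphism r r' ((a, b) :: l).
Proof.
move=> al [bl bP].
have [rI _ _] := rC; have [r'I _ _] := r'C.
have ab p : p \in l -> [/\ p.1 <> a, p.2 <> b, r p.1 a <-> r' p.2 b & r a p.1 <-> r' b p.2].
  move=> pl; have [Lb Ub] := bP p.2 (map_f snd pl); split.
  - by move=> pa; case/negP: al; rewrite -pa map_f.
  - by move=> pb; case/negP: bl; rewrite -pb map_f.
  - by apply: (iff_trans _ (iff_sym Lb)); split=> [pa|[q ql [/(rl ql pl).1 <-]]//]; exists p.
  - by apply: (iff_trans _ (iff_sym Ub)); split=> [pa|[q ql [/(rl ql pl).1 <-]]//]; exists p.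
move=> p q; rewrite !inE => /orP[/eqP->|pl] /orP[/eqP->|ql] /=.
- by split; split => // [/rI|/r'I].
- by have [pa pb ? ?] := ab q ql; split => //; split=> /esym.
- by have [pa pb ? ?] := ab p pl; split.
- exact: rl.
Qed.

End PartialIsomorphism.

Lemma partial_isomorphism_extend (A B : eqType) (r : A -> A -> Prop)
    (r' : B -> B -> Prop) (l : seq (A * B)) (a : A) :
  relation_class r -> relation_class r' -> extension_property r' ->
  partial_isomorphism r r' l ->
  exists l', [/\ partial_isomorphism r r' l', {subset l <= l'} & a \in map fst l'].
Proof.
move=> rC r'C r'E rl; have [al|al] := boolP (a \in map fst l).
  by exists l; split.
have [b bP] := r'E _ _ _ (image_one_point_type rC a rl).
exists ((a, b) :: l); split; last by rewrite inE eqxx.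
  exact: partial_isomorphism_cons.
by move=> p pl; rewrite inE pl orbT.
Qed.

(** Step [n] brings the points with code [n] into the domain and, through the inverse, into the
    range of a finite partial isomorphism. *)
Lemma back_and_forth (A B : countType) (r : A -> A -> Prop)
    (r' : B -> B -> Prop) (l0 : seq (A * B)) :
  relation_class r -> relation_class r' ->
  extension_property r -> extension_property r' ->
  partial_isomorphism r r' l0 ->
  exists (phi : A -> B) (psi : B -> A), [/\ cancel phi psi, cancel psi phi,
    forall x y, r x y <-> r' (phi x) (phi y) & {in l0, forall p, phi p.1 = p.2}].
Proof.
move=> rC r'C rE r'E rl0.
have [step stepP] : {step : nat * seq (A * B) -> seq (A * B) & forall nl,
    partial_isomorphism r r' nl.2 -> [/\ partial_isomorphism r r' (step nl),
      {subset nl.2 <= step nl},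
      forall a, pickle a = nl.1 -> a \in map fst (step nl) &
      forall b, pickle b = nl.1 -> b \in map snd (step nl)]}.
  apply: (@choice _ _ (fun nl l' => partial_isomorphism r r' nl.2 ->
    [/\ partial_isomorphism r r' l', {subset nl.2 <= l'},
      forall a, pickle a = nl.1 -> a \in map fst l' &
      forall b, pickle b = nl.1 -> b \in map snd l'])) => -[n l] /=.
  have [rl|nrl] := pselect (partial_isomorphism r r' l); last by exists l.
  have [l1 [rl1 ll1 l1n]] : exists l1, [/\ partial_isomorphism r r' l1,
      {subset l <= l1} & forall a : A, pickle a = n -> a \in map fst l1].
    case na: (unpickle n : option A) => [a|]; last first.
      by exists l; split => // a an; rewrite -an pickleK in na.
    have [l1 [rl1 ll1 al1]] := partial_isomorphism_extend a rC r'C r'E rl.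
    by exists l1; split => // a' an; move: na; rewrite -an pickleK => -[->].
  case nb: (unpickle n : option B) => [b|]; last first.
    by exists l1; split => // b bn; rewrite -bn pickleK in nb.
  have [l2 [rl2 ll2 bl2]] :=
    partial_isomorphism_extend b r'C rC rE (partial_isomorphism_sym rl1).
  have l12 : {subset l1 <= [seq (p.2, p.1) | p <- l2]}.
    move=> p pl1; apply/mapP; exists (p.2, p.1); last by case: p {pl1}.
    by apply: ll2; apply/mapP; exists p.
  exists [seq (p.2, p.1) | p <- l2] => _; split.
  - exact: partial_isomorphism_sym.
  - by move=> p /ll1; exact: l12.
  - move=> a /l1n /mapP[p /l12 pl ->]; exact: map_f.
  - move=> b' b'n; move: nb; rewrite -b'n pickleK => -[->].
    by rewrite -map_comp.
pose z := fix z n := if n is m.+1 then step (m, z m) else l0.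
have zl n : partial_isomorphism r r' (z n).
  by elim: n => // n IH; have [] := stepP (n, z n) IH.
have zsub m n : (m <= n)%N -> {subset z m <= z n}.
  elim: n => [|n IH]; first by rewrite leqn0 => /eqP ->.
  rewrite leq_eqVlt ltnS => /orP[/eqP->//|/IH mn] p /mn.
  by have [_ + _ _] := stepP (n, z n) (zl n); apply.
pose G p := exists n, p \in z n.
have GP p q : G p -> G q -> (p.1 = q.1 <-> p.2 = q.2) /\ (r p.1 q.1 <-> r' p.2 q.2).
  move=> [m pm] [n qn]; apply: (zl (maxn m n)).
    by apply: zsub pm; rewrite leq_maxl.
  by apply: zsub qn; rewrite leq_maxr.
have /choice[phi phiP] a : exists b, G (a, b).
  have [_ _ /(_ a erefl) /mapP[p pz ap] _] := stepP (pickle a, z (pickle a)) (zl _).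
  exists p.2, (pickle a).+1.
  by rewrite (_ : (a, p.2) = p) // [RHS]surjective_pairing -ap.
have /choice[psi psiP] b : exists a, G (a, b).
  have [_ _ _ /(_ b erefl) /mapP[p pz bp]] := stepP (pickle b, z (pickle b)) (zl _).
  exists p.1, (pickle b).+1.
  by rewrite (_ : (p.1, b) = p) // [RHS]surjective_pairing -bp.
exists phi, psi; split.
- by move=> a; exact: ((GP _ _ (psiP (phi a)) (phiP a)).1.2 erefl).
- by move=> b; exact: ((GP _ _ (phiP (psi b)) (psiP b)).1.1 erefl).
- by move=> x y; exact: (GP _ _ (phiP x) (phiP y)).2.
- move=> p pl; have Gp : G p by exists 0%N.
  exact: ((GP _ _ (phiP p.1) Gp).1.1 erefl).
Qed.

End RelationClass.

(** * Free extensions *)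

(* Starting from a relation [m] on [M], points [inr n] are adjoined one at a
   time. The n-th request [(L, U, y)] asks for a point above [L], below [U] that
   is mapped by [free_hom] to [y]; it is granted, with no more relations than
   necessary, provided that it is consistent. Every request occurs infinitely
   often in the enumeration. *)
Section FreeExtension.
Variables (sym tr : bool) (M T : countType).
Variables (m : M -> M -> Prop) (e : T -> T -> Prop) (s : M -> T) (t0 : T).
Hypothesis mC : relation_class sym tr m.
Hypothesis eT : tr -> forall x y z, e x y -> e y z -> e x z.
Hypothesis s_hom : forall x y, m x y -> e (s x) (s y).

Notation Z := (M + nat)%type.
Implicit Types (a b c : Z) (r : Z -> Z -> Prop) (L U : seq Z).

(** Decoding only the exponent of [2] in [n] makes each request recur, in particular after any given
    points have been adjoined. *)
Definition request n : seq Z * seq Z * T := odflt ([::], [::], t0) (unpickle (logn 2 n)).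

Lemma exists_request (q : seq Z * seq Z * T) N : exists2 n, (N <= n)%N & request n = q.
Proof.
exists (2 ^ pickle q * N.*2.+1)%N.
  rewrite (@leq_trans N.*2.+1) //; last by rewrite leq_pmull // expn_gt0.
  by rewrite -addnn -addnS leq_addr.
rewrite /request lognM ?expn_gt0 // pfactorK // lognE /= dvdn2 /= odd_double /=.
by rewrite addn0 pickleK.
Qed.

Definition free_hom a : T := match a with inl x => s x | inr n => (request n).2 end.

(** What a new point above [L] must have below it: [L], closed downwards in the transitive case. *)
Definition below r L a := exists2 l, l \in L & a = l \/ tr /\ r a l.
Definition above r U b := exists2 u, u \in U & b = u \/ tr /\ r u b.

Definition active n a := if a is inr k then (k < n)%N else true.

Definition consistent n r := let: (L, U, y) := request n in
  [/\ all (active n) L /\ all (active n) U, sym -> L =i U,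
    tr -> forall l u, l \in L -> u \in U -> r l u,
    forall l, l \in L -> e (free_hom l) y & forall u, u \in U -> e y (free_hom u)].

(** All points exist from the start; [stage n] fixes the relations among those active at [n]. If
    request [k] is refused, [inr k] stays unrelated to the points active at [k]. *)
Fixpoint stage n : Z -> Z -> Prop :=
  if n is k.+1 then fun a b => stage k a b \/ consistent k (stage k) /\
    (b = inr k /\ below (stage k) (request k).1.1 a \/
     a = inr k /\ above (stage k) (request k).1.2 b)
  else fun a b => match a, b with inl x, inl y => m x y | _, _ => False end.

Definition free_extension a b := exists n, stage n a b.

Lemma activeW k n a : (k <= n)%N -> active k a -> active n a.
Proof. by case: a => //= j kn jk; exact: leq_trans kn. Qed.

Lemma stage_active n a b : stage n a b -> active n a /\ active n b.
Proof.
elim: n a b => [|n IH] a b /=; first by case: a b => [x|k] [y|k'].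
move=> [/IH [? ?]|]; first by split; exact: (@activeW n).
rewrite /consistent; case: request => [[L U] y] /= [[[aL aU] _ _ _ _]].
case=> [[-> [l lL al]]|[-> [u uU ub]]]; split; rewrite /= ?ltnS //; apply: (@activeW n) => //.
  by case: al => [->|[_ /IH[]]]; [exact: (allP aL) | ].
by case: ub => [->|[_ /IH[]]]; [exact: (allP aU) | ].
Qed.

Lemma stage_inactive n a : ~ stage n a (inr n) /\ ~ stage n (inr n) a.
Proof. by split=> /stage_active [] /=; rewrite ltnn. Qed.

Lemma stageW k n a b : (k <= n)%N -> stage k a b -> stage n a b.
Proof.
elim: n => [|n IH]; first by rewrite leqn0 => /eqP ->.
by rewrite leq_eqVlt ltnS => /orP[/eqP->//|/IH kn] /kn; left.
Qed.

Lemma stage_restrict k n a b : active k a -> active k b -> (k <= n)%N ->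
  stage n a b -> stage k a b.
Proof.
move=> ak bk; elim: n => [|n IH]; first by rewrite leqn0 => /eqP ->.
rewrite leq_eqVlt => /orP[/eqP->//|kn] /=; rewrite ltnS in kn.
move=> [|[_ [[bn _]|[an _]]]]; first exact: IH.
  by rewrite bn /= ltnNge kn in bk.
by rewrite an /= ltnNge kn in ak.
Qed.

Lemma free_extension_stage n a b : active n a -> active n b ->
  free_extension a b <-> stage n a b.
Proof.
move=> an bn; split=> [[k kab]|]; last by exists n.
have [nk|/ltnW kn] := leqP n k; first exact: stage_restrict kab.
exact: stageW kab.
Qed.

Lemma stage_class n : relation_class sym tr (stage n).
Proof.
elim: n => [|n [rI rS rT]].
  have [mI mS mT] := mC; split.
  - by case=> [x|k] /= => [/mI|].
  - by move=> sy [x|k] [y|k'] //=; exact: mS.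
  - by move=> tt [x|k] [y|k'] [z|k''] //=; exact: mT.
have inact a := stage_inactive n a.
have inactC a : stage n a (inr n) -> False by have [] := inact a.
have inactC' a : stage n (inr n) a -> False by have [] := inact a.
split=> /=; rewrite /consistent; case Dq: (request n) => [[L U] y] /=.
- move=> a [/rI//|[[[aL aU] _ _ _ _] [[-> [l lL]]|[-> [u uU]]]]].
    by move=> [nl|[_ /inactC' //]]; have := allP aL l lL; rewrite -nl /= ltnn.
  by move=> [nu|[_ /inactC //]]; have := allP aU u uU; rewrite -nu /= ltnn.
- move=> sy a b [/(rS sy)|[cn]]; first by left.
  have [_ /(_ sy) LU _ _ _] := cn.
  case=> [[-> [l lL al]]|[-> [u uU ub]]]; right; split => //; [right|left]; split => //.
    by exists l; rewrite -?LU //; case: al => [|[? /(rS sy)]]; [left|right].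
  by exists u; rewrite ?LU //; case: ub => [|[? /(rS sy)]]; [left|right].
move=> tt a b c.
have belowW a' b' : stage n a' b' -> below (stage n) L b' -> below (stage n) L a'.
  move=> ab [l lL bl]; exists l => //; right; split=> //.
  by case: bl ab => [->//|[_ bl] ab]; exact: (rT tt) ab bl.
have aboveW b' c' : stage n b' c' -> above (stage n) U b' -> above (stage n) U c'.
  move=> bc [u uU ub]; exists u => //; right; split=> //.
  by case: ub bc => [->//|[_ ub] bc]; exact: (rT tt) ub bc.
move=> [ab|[cn [[-> aL]|[-> bU]]]] [bc|[cn' [[cE bL]|[bE cU]]]].
- by left; exact: (rT tt) ab bc.
- by right; split=> //; left; split=> //; exact: belowW bL.
- by move: ab; rewrite bE => /inactC.
- by move: bc => /inactC'.
- have [[aL' _] _ _ _ _] := cn; case: bL => l lL [nl|[_ /inactC' //]].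
  by have := allP aL' l lL; rewrite -nl /= ltnn.
(* [b] is the new point: [a] is at or below some [l], which is below some [u], which is at or below
   [c]. *)
- have [_ _ /(_ tt) LU _ _] := cn; left.
  have [l lL al] := aL; have [u uU uc] := cU.
  have {}al z : stage n l z -> stage n a z.
    by case: al => [->//|[_ al]] lz; exact: (rT tt) al lz.
  by apply: al; case: uc => [->|[_ uc]]; [exact: LU | exact: (rT tt) (LU _ _ lL uU) uc].
- by right; split => //; right; split=> //; exact: aboveW bU.
(* [a] and [c] are both the new point: [b] would be at or above some [u] and at or below some [l],
   closing a cycle with [l] below [u]. *)
- have [_ _ /(_ tt) LU _ _] := cn.
  have [l lL bl] := bL; have [u uU ub] := bU; exfalso; apply: (rI l).
  have ul : u = l \/ stage n u l.
    case: ub bl => [->|[_ ub]] [bl|[_ bl]]; [by left|by right| |].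
      by right; rewrite -bl.
    by right; exact: (rT tt) ub bl.
  by case: ul (LU _ _ lL uU) => [->//|ul lu]; exact: (rT tt) lu ul.
- have [[_ aU] _ _ _ _] := cn; case: bU => u uU.
  rewrite bE => -[nu|[_ /inactC //]].
  by have := allP aU u uU; rewrite -nu /= ltnn.
Qed.

Lemma free_hom_stage n a b : stage n a b -> e (free_hom a) (free_hom b).
Proof.
elim: n a b => [|n IH] a b /=; first by case: a b => [x|k] [y|k'] //=; exact: s_hom.
case=> [/IH//|]; rewrite /consistent.
case Dq: (request n) => [[L U] y] /= [[_ _ _ eL eU]].
case=> [[-> [l lL al]]|[-> [u uU ub]]]; rewrite /= Dq /=.
  by case: al => [->|[tt /IH al]]; [exact: eL | exact: eT tt _ _ _ al (eL l lL)].
by case: ub => [->|[tt /IH ub]]; [exact: eU | exact: eT tt _ _ _ (eU u uU) ub].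
Qed.

Lemma free_hom_edge a b : free_extension a b -> e (free_hom a) (free_hom b).
Proof. by move=> [n /free_hom_stage]. Qed.

Lemma free_extension_inl x y : free_extension (inl x) (inl y) <-> m x y.
Proof. by rewrite (@free_extension_stage 0). Qed.

Lemma active_seq (P : seq Z) : exists N, forall n, (N <= n)%N -> {in P, forall a, active n a}.
Proof.
elim: P => [|a P [N HN]]; first by exists 0%N.
exists (maxn N (if a is inr k then k.+1 else 0%N)) => n.
rewrite geq_max => /andP[/HN Pn an] b; rewrite inE => /orP[/eqP->|/Pn//].
by case: a an => //= k.
Qed.

Lemma free_extension_class : relation_class sym tr free_extension.
Proof.
have stg a b c : exists n, [/\ active n a, active n b & active n c].
  have [n /(_ n (leqnn n)) nP] := active_seq [:: a; b; c].
  by exists n; split; apply: nP; rewrite !inE eqxx ?orbT.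
split=> [a [n]|sy a b [n ab]|tt a b c].
- by have [rI _ _] := stage_class n => /rI.
- by exists n; have [_ rS _] := stage_class n; exact: rS.
- have [n [an bn cn]] := stg a b c; rewrite !(@free_extension_stage n) //.
  by have [_ _ rT] := stage_class n; exact: rT.
Qed.

(** The request recurs once all of [P] is active, and is then granted. In the transitive case [L]
    and [U] are closed within [P], so closure adds no relation with points of [P]. *)
Lemma free_extension_realizes (P : seq Z) (L U : Z -> Prop) (y : T) :
  one_point_type sym tr free_extension P L U ->
  {in P, forall p, L p -> e (free_hom p) y} ->
  {in P, forall p, U p -> e y (free_hom p)} ->
  exists2 v, realizes free_extension P L U v & free_hom v = y.
Proof.
move=> [tS tT] Ly Uy.
have [N HN] := active_seq P.
pose Lq := [seq p <- P | `[< L p >]]; pose Uq := [seq p <- P | `[< U p >]].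
have LqP p : p \in Lq <-> p \in P /\ L p.
  by rewrite mem_filter; split=> [/andP[/asboolP]|[pP /asboolP ->]].
have UqP p : p \in Uq <-> p \in P /\ U p.
  by rewrite mem_filter; split=> [/andP[/asboolP]|[pP /asboolP ->]].
have [n nN nq] := exists_request (Lq, Uq, y) N.
have Pn := HN n nN.
have cn : consistent n (stage n).
  rewrite /consistent nq; split.
  - by split; apply/allP => p; [case/LqP|case/UqP] => /Pn.
  - by move=> sy p; apply/idP/idP => [/LqP[pP]|/UqP[pP]]; [move/(tS sy p pP)/(conj pP)/UqP | move/(tS sy p pP)/(conj pP)/LqP].
  - move=> tt l u /LqP[lP Ll] /UqP[uP Uu].
    rewrite -(@free_extension_stage n) ?Pn //.
    by have [_ _] := tT tt; apply.
  - by move=> l /LqP[lP]; exact: Ly.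
  - by move=> l /UqP[lP]; exact: Uy.
exists (inr n); last by rewrite /= nq.
split=> [|p pP]; first by apply/negP => /Pn /=; rewrite ltnn.
have pn1 : active n.+1 p by apply: (@activeW n); rewrite ?Pn.
have nn1 : active n.+1 (inr n) by rewrite /= ltnSn.
have pNn : p <> inr n by move=> pn; have := Pn p pP; rewrite pn /= ltnn.
have [out1 out2] := stage_inactive n p.
rewrite !(@free_extension_stage n.+1) //= nq /=; split.
  split=> [[//|[_ [[_ [l /LqP[lP Ll] [->//|[tt pl]]]]|[/pNn]//]]]|Lp].
    have [H _ _] := tT tt; apply: (H p l) => //.
    by apply/(@free_extension_stage n); rewrite ?Pn.
  by right; split => //; left; split=> //; exists p; [apply/LqP | left].
split=> [[//|[_ [[/pNn]//|[_ [u /UqP[uP Uu] [->//|[tt up]]]]]]]|Up].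
  have [_ H _] := tT tt; apply: (H u p) => //.
  by apply/(@free_extension_stage n); rewrite ?Pn.
by right; split => //; right; split=> //; exists p; [apply/UqP | left].
Qed.

Lemma free_extension_EP :
  (forall L U : seq T, (sym -> L =i U) ->
     (tr -> forall l u, l \in L -> u \in U -> e l u) ->
     exists y, (forall l, l \in L -> e l y) /\ (forall u, u \in U -> e y u)) ->
  extension_property sym tr free_extension.
Proof.
move=> amalg P L U tLU; have [tS tT] := tLU.
pose Lq := [seq free_hom p | p <- P & `[< L p >]].
pose Uq := [seq free_hom p | p <- P & `[< U p >]].
have LqP p : p \in P -> L p -> free_hom p \in Lq.
  by move=> pP Lp; apply: map_f; rewrite mem_filter pP andbT; apply/asboolP.
have UqP p : p \in P -> U p -> free_hom p \in Uq.
  by move=> pP Up; apply: map_f; rewrite mem_filter pP andbT; apply/asboolP.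
have [||y [Ly Uy]] := amalg Lq Uq.
- move=> sy x; apply/idP/idP => /mapP[p]; rewrite mem_filter => /andP[/asboolP pLU pP] ->.
    by apply: UqP => //; apply/(tS sy p pP).
  by apply: LqP => //; apply/(tS sy p pP).
- move=> tt _ _ /mapP[p + ->] /mapP[q + ->].
  rewrite !mem_filter => /andP[/asboolP Lp pP] /andP[/asboolP Uq' qP].
  by apply: free_hom_edge; have [_ _] := tT tt; apply.
have [v vP _] := @free_extension_realizes P L U y tLU
  (fun p pP Lp => Ly _ (LqP p pP Lp)) (fun p pP Up => Uy _ (UqP p pP Up)).
by exists v.
Qed.

(** The induction step for [finitely_below] and, with both relations reversed, [finitely_above]: an
    element of [L] in [M] dominates by itself, and one outside [M] is handled by the hypothesis on
    earlier points. *)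
Lemma dominated_seq k (w : Z -> Z -> Prop) (n : M -> M -> Prop) L :
  all (active k) L -> (forall x y, w (inl x) (inl y) -> n x y) ->
  (forall j, (j < k)%N -> exists D : seq M, forall x, w (inl x) (inr j) ->
     exists2 d, d \in D & (x = d \/ tr /\ n x d) /\ w (inl d) (inr j)) ->
  exists D : seq M, forall x,
    (exists2 l, l \in L & inl x = l \/ tr /\ w (inl x) l) ->
    exists2 d, d \in D & (x = d \/ tr /\ n x d) /\
      exists2 l, l \in L & inl d = l \/ tr /\ w (inl d) l.
Proof.
move=> + wn wk; elim: L => [_|l L IHL /= /andP[lk /IHL [D HD]]].
  by exists [::] => x [].
have [D' HD'] : exists D' : seq M, forall x, inl x = l \/ tr /\ w (inl x) l ->
    exists2 d, d \in D' & (x = d \/ tr /\ n x d) /\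
      (inl d = l \/ tr /\ w (inl d) l).
  case: l lk => [x _|j jk].
    exists [:: x] => z zx; exists x; rewrite ?mem_head //; split; last by left.
    by case: zx => [[->]|[tt /wn zx]]; [left | right].
  have [D' HD'] := wk j jk; exists D' => x [//|[tt /HD' [d dD' [xd dj]]]].
  by exists d => //; split => //; right.
exists (D' ++ D) => x [l']; rewrite inE => /orP[/eqP-> /HD' [d dD' [xd dl]]|l'L xl'].
  exists d; first by rewrite mem_cat dD'.
  by split => //; exists l; rewrite ?mem_head.
have [|d dD [xd [l'' l''L dl'']]] := HD x; first by exists l'.
exists d; first by rewrite mem_cat dD orbT.
by split => //; exists l''; rewrite // inE l''L orbT.
Qed.

(* A point [inr k] is related to [M] only through finitely many elements of
   [M]: this is where it matters that the extension is free. *)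
Lemma finitely_below k : exists D : seq M, forall x,
  free_extension (inl x) (inr k) -> exists2 d, d \in D &
    (x = d \/ tr /\ m x d) /\ free_extension (inl d) (inr k).
Proof.
elim/ltn_ind: k => k IH.
have Ek x : free_extension (inl x) (inr k) <->
    consistent k (stage k) /\ below (stage k) (request k).1.1 (inl x).
  rewrite (@free_extension_stage k.+1) /= ?ltnSn //.
  have [out _] := stage_inactive k (inl x).
  by split=> [[/out//|[cn [[_]|[]]]]|[cn xk]] //; right; split=> //; left.
have [cn|ncn] := pselect (consistent k (stage k)); last first.
  by exists [::] => x /Ek [].
have Lk : all (active k) (request k).1.1.
  by move: cn; rewrite /consistent; case: request => [[L U] y] [[]].
have [x y xy|j jk|D HD] := dominated_seq (w := stage k) (n := m) Lk.
- by apply/free_extension_inl; exists k.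
- have [D HD] := IH j jk; exists D => x.
  by rewrite -(@free_extension_stage k) // => /HD [d dD [xd ?]]; exists d;
    rewrite // -(@free_extension_stage k).
by exists D => x /Ek [_ /HD [d dD [xd dk]]]; exists d => //; rewrite Ek.
Qed.

Lemma finitely_above k : exists D : seq M, forall x,
  free_extension (inr k) (inl x) -> exists2 d, d \in D &
    (x = d \/ tr /\ m d x) /\ free_extension (inr k) (inl d).
Proof.
elim/ltn_ind: k => k IH.
have Ek x : free_extension (inr k) (inl x) <->
    consistent k (stage k) /\ above (stage k) (request k).1.2 (inl x).
  rewrite (@free_extension_stage k.+1) /= ?ltnSn //.
  have [_ out] := stage_inactive k (inl x).
  by split=> [[/out//|[cn [[]|[_]]]]|[cn xk]] //; right; split=> //; right.
have [cn|ncn] := pselect (consistent k (stage k)); last first.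
  by exists [::] => x /Ek [].
have Uk : all (active k) (request k).1.2.
  by move: cn; rewrite /consistent; case: request => [[L U] y] [[]].
have [x y xy|j jk|D HD] :=
    dominated_seq (w := fun a b => stage k b a) (n := fun x y => m y x) Uk.
- by apply/free_extension_inl; exists k.
- have [D HD] := IH j jk; exists D => x.
  by rewrite -(@free_extension_stage k) // => /HD [d dD [xd ?]]; exists d;
    rewrite // -(@free_extension_stage k).
by exists D => x /Ek [_ /HD [d dD [xd dk]]]; exists d => //; rewrite Ek.
Qed.

End FreeExtension.

(** * Fraïssé limits *)

Section FraisseLimit.
Variables (sym tr : bool) (C : structure -> Prop).
Hypothesis CE : forall A : structure, C A <-> relation_class sym tr (@edge A).
Variables (T : countType) (r : T -> T -> Prop).
Hypothesis rF : fraisse_limit C (@Structure T r).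

Let finite_class (A : finType) (q : A -> A -> Prop) :
  relation_class sym tr q -> exists f : A -> T, @embedding (@Structure A q) (@Structure T r) f.
Proof.
move=> qC; have [_ ageC _] := rF.
suff /ageC[_] : finite_structure (@Structure A q) /\ C (@Structure A q) by [].
by split; [exact: finite_finset | apply/CE].
Qed.

(** Each axiom involves at most three points, so it is inherited from finite substructures. *)
Lemma fraisse_limit_class : relation_class sym tr r.
Proof.
have [_ ageC _] := rF.
have sub (l : seq T) : relation_class sym tr (fun x y : seq_sub l => r (val x) (val y)).
  have /ageC[_ /CE//] : age (@Structure T r) (@Structure (seq_sub l) (fun x y => r (val x) (val y))).
  split; first exact: finite_finset.
  by exists val; split => //; exact: val_inj.
split.
- move=> x; have [rI _ _] := sub [:: x].
  by have := rI (SeqSub (mem_head x [::])).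
- move=> sy x y; have [_ rS _] := sub [:: x; y].
  have xl : x \in [:: x; y] by rewrite !inE eqxx.
  have yl : y \in [:: x; y] by rewrite !inE eqxx orbT.
  by have := rS sy (SeqSub xl) (SeqSub yl).
- move=> tt x y z; have [_ _ rT] := sub [:: x; y; z].
  have xl : x \in [:: x; y; z] by rewrite !inE eqxx.
  have yl : y \in [:: x; y; z] by rewrite !inE eqxx orbT.
  have zl : z \in [:: x; y; z] by rewrite !inE eqxx !orbT.
  by have := rT tt (SeqSub xl) (SeqSub yl) (SeqSub zl).
Qed.

(** [P] with the new point [None] is a finite structure in the class, so it embeds by [f].
    Ultrahomogeneity moves the copy of [P] back onto [P], and the image of [None] is the desired
    point. *)
Lemma fraisse_limit_EP : extension_property sym tr r.
Proof.
have [rI rS rT] := fraisse_limit_class.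
move=> P L U [tS tT].
pose A := option (seq_sub P).
pose q (a b : A) := match a, b with
  | Some x, Some y => r (val x) (val y) | Some x, None => L (val x)
  | None, Some y => U (val y) | None, None => False end.
have qC : relation_class sym tr q.
  split.
  - by case=> [x|] /= => [/rI|].
  - move=> sy [x|] [y|] //=; first exact: rS.
      by move/(tS sy _ (valP x)).
    by move/(tS sy _ (valP y)).
  move=> tt; have [tL tU tLU] := tT tt; move=> [x|] [y|] [z|] //=.
  - exact: (rT tt).
  - by move=> xy Ly; exact: tL (valP x) (valP y) xy Ly.
  - by move=> Lx Uz; exact: tLU (valP x) (valP z) Lx Uz.
  - by move=> Uy yz; exact: tU (valP y) (valP z) yz Uy.
  - by move=> Uy Ly; exact: rI (tLU _ _ (valP y) (valP y) Ly Uy).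
have [f [fI fq']] := finite_class qC.
have {fq'} fq a b : q a b <-> r (f a) (f b) := fq' a b.
have [_ _ hom] := rF.
pose F x := if pselect (exists a, f (Some a) = x) is left h then val (projT1 (cid h)) else x.
have FE a : F (f (Some a)) = val a.
  rewrite /F; case: pselect => [h|[]]; last by exists a.
  by case: (cid h) => a' /= /fI [->].
have [|x y [a _ <-] [b _ <-]|x y [a _ <-] [b _ <-]|al [[[al' alK al'K] al_edge] alF]] :=
    hom (range (f \o Some)) F.
- exact/finite_image/finite_finset.
- by rewrite !FE => /val_inj ->.
- by rewrite /= !FE -(fq (Some a) (Some b)).
have alE a : al (f (Some a)) = val a by rewrite alF ?FE //; exists a.
have {}al_edge x y : r x y <-> r (al x) (al y) := al_edge x y.
exists (al (f None)); split.
  apply/negP => vP; have := alE (SeqSub vP).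
  by move=> /(can_inj alK)/fI.
move=> p pP; have alp : al (f (Some (SeqSub pP))) = p := alE (SeqSub pP).
split; rewrite -{1}alp -al_edge.
  by rewrite -(fq (Some (SeqSub pP)) None).
by rewrite -(fq None (Some (SeqSub pP))).
Qed.

End FraisseLimit.

(** If [r x y], the down-set of [x] is properly contained in that of [y], so their first difference
    lies in the latter; distinct points have distinct down-sets. *)
Lemma exists_linear_extension (A : countType) (r : A -> A -> Prop) :
  (forall x, ~ r x x) -> (forall x y z, r x y -> r y z -> r x z) ->
  exists l : A -> A -> Prop, [/\ forall x, ~ l x x,
    forall x y z, l x y -> l y z -> l x z, forall x y, r x y -> l x y &
    forall x y, x <> y -> l x y \/ l y x].
Proof.
move=> rI rT.
(* compare the down-sets of [x] and [y] lexicographically *)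
pose dn x z := z = x \/ r z x.
pose l x y := exists z, [/\ ~ dn x z, dn y z &
  forall z', (pickle z' < pickle z)%N -> dn x z' <-> dn y z'].
have ltot x y : ~ (forall z, dn x z <-> dn y z) -> l x y \/ l y x.
  move=> nxy.
  have diff : exists n, `[< exists2 z, pickle z = n & ~ (dn x z <-> dn y z) >].
    have [z nz] : exists z, ~ (dn x z <-> dn y z) by apply/existsNP.
    by exists (pickle z); apply/asboolP; exists z.
  case: (ex_minnP diff) => n /asboolP[z zn nz] nmin.
  have small z' : (pickle z' < pickle z)%N -> dn x z' <-> dn y z'.
    move=> z'z; apply: contrapT => nz'; move: z'z; rewrite ltnNge => /negP; apply.
    by rewrite zn; apply/nmin/asboolP; exists z'.
  have [xz|xz] := pselect (dn x z); have [yz|yz] := pselect (dn y z).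
  - by case: nz.
  - by right; exists z; split => // z' /small ?; exact: iff_sym.
  - by left; exists z.
  - by case: nz.
have ndn x y : r x y -> ~ dn x y.
  by move=> xy [yx|yx]; [apply: (rI x); rewrite -{2}yx | exact: (rI x (rT _ _ _ xy yx))].
exists l; split.
- by move=> x [z []].
- move=> x y z [a [xa ya xy]] [b [yb zb yz]].
  have [ab|ba|ab] := ltngtP (pickle a) (pickle b).
  + exists a; split => //; first by apply/yz.
    by move=> c ca; apply: (iff_trans (xy _ ca)); apply: yz; exact: ltn_trans ab.
  + exists b; split => //; first by move/(xy _ ba).
    by move=> c cb; apply: (iff_trans _ (yz _ cb)); apply: xy; exact: ltn_trans ba.
  + by move: yb; rewrite -((pcan_inj pickleK) _ _ ab).
- move=> x y xy; have [|//|[z [nyz xz _]]] := ltot x y.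
    by move=> /(_ y) [_ H]; apply: (ndn _ _ xy); apply: H; left.
  by case: nyz; case: xz => [->|zx]; right => //; exact: rT zx xy.
- move=> x y nxy; apply: ltot => dxy.
  have [//|xy] : dn y x by apply/dxy; left.
  by apply: (ndn _ _ xy); apply/dxy; left.
Qed.

(** * Relations with the extension property, with or without loops *)

Section HomogeneousStructure.
Variables (sym tr loops : bool) (T : countType) (r : T -> T -> Prop).
Hypothesis symtr : ~~ (sym && tr).
Hypothesis rC : relation_class sym tr r.
Hypothesis rE : extension_property sym tr r.

Definition looped x y := r x y \/ loops /\ x = y.
Notation X := (@Structure T looped).

Let rX x y : r x y -> looped x y. Proof. by left. Qed.

Let mk_endo (F : T -> T) : (forall x y, r x y -> looped (F x) (F y)) ->
  {f : endo X | forall x, f x = F x}.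
Proof.
move=> FE; suff FX x y : looped x y -> looped (F x) (F y) by exists (@Endo X F FX).
by move=> [/FE//|[ll ->]]; right.
Qed.

Lemma looped_trans : tr -> forall x y z, looped x y -> looped y z -> looped x z.
Proof.
have [_ _ rT] := rC => tt x y z [xy|[_ ->]] // [yz|[ll <-]]; left => //.
exact: (rT tt) xy yz.
Qed.

(** This provides the values of [free_hom] required by [free_extension_EP]. In the transitive case a
    common element of [L] and [U] is such a value; otherwise the extension property applies to the
    closures of [L] and [U]. *)
Lemma looped_amalgam (L U : seq T) : (sym -> L =i U) ->
  (tr -> forall l u, l \in L -> u \in U -> looped l u) ->
  exists y, (forall l, l \in L -> looped l y) /\ (forall u, u \in U -> looped y u).
Proof.
have [rI rS rT] := rC => LU LUr.
have [[tt [y [yL yU]]]|nLU] := pselect (tr /\ exists y, y \in L /\ y \in U).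
  by exists y; split=> z zLU; exact: (LUr tt).
have LUr' : tr -> forall l u, l \in L -> u \in U -> r l u.
  move=> tt l u lL uU; case: (LUr tt l u lL uU) => // -[_ lu].
  by case: nLU; split=> //; exists l; split; rewrite // lu.
pose L' p := exists2 l, l \in L & p = l \/ tr /\ r p l.
pose U' p := exists2 u, u \in U & p = u \/ tr /\ r u p.
have [|v [_ vP]] := rE (P := L ++ U) (L := L') (U := U').
  split=> [sy p _|tt].
    split=> -[q qLU pq]; exists q; rewrite ?LU // -?LU //.
      by case: pq => [|[? /(rS sy)]]; [left | right].
    by case: pq => [|[? /(rS sy)]]; [left | right].
  split=> p q _ _.
  - move=> pq [l lL ql]; exists l => //; right; split => //.
    by case: ql pq => [->//|[_ ql] pq]; exact: (rT tt) pq ql.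
  - move=> pq [u uU up]; exists u => //; right; split => //.
    by case: up pq => [->//|[_ up] pq]; exact: (rT tt) up pq.
  - move=> [l lL pl] [u uU uq]; have lu := LUr' tt l u lL uU.
    have {lu}pu : r p u by case: pl => [->//|[_ pl]]; exact: (rT tt) pl lu.
    by case: uq => [->//|[_ uq]]; exact: (rT tt) pu uq.
exists v; split=> [l lL|u uU]; left.
  by apply/(vP l _).1; [rewrite mem_cat lL | exists l; [|left]].
by apply/(vP u _).2; [rewrite mem_cat uU orbT | exists u; [|left]].
Qed.

Lemma exists_point : exists t : T, True.
Proof.
by have [//|//|v _] := @looped_amalgam [::] [::]; exists v.
Qed.

Lemma automorphism_approximable_looped : automorphism_approximable looped.
Proof.
move=> s; have [t0 _] := exists_point.
have s_hom x y : r x y -> looped (s x) (s y) by move=> /rX; exact: (@endo_edge X).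
pose Z := (T + nat)%type.
pose q := free_extension sym tr r looped s t0.
pose g0 := free_hom s t0.
have qC : relation_class sym tr q.
  exact: free_extension_class.
have qE : extension_property sym tr q.
  by apply: free_extension_EP => //; [exact: looped_trans|exact: looped_amalgam].
have g0_hom a b : q a b -> looped (g0 a) (g0 b).
  by apply: free_hom_edge => //; exact: looped_trans.
have q_inl x y : q (inl x) (inl y) <-> r x y by exact: free_extension_inl.
have [phi [psi [phiK psiK phiE _]]] : exists (phi : Z -> T) (psi : T -> Z),
    [/\ cancel phi psi, cancel psi phi, forall x y, q x y <-> r (phi x) (phi y) &
      {in [::], forall p : Z * T, phi p.1 = p.2}].
  exact: (back_and_forth qC rC qE rE).
(* Through the isomorphism [phi], [f] is the inclusion of [T] in its free extension and [g] is the
   extension [g0] of [s]. *)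
have [f fE] : {f : endo X | forall x, f x = phi (inl x)}.
  by apply: mk_endo => x y xy; left; apply/phiE/q_inl.
have [g gE] : {g : endo X | forall x, g x = g0 (psi x)}.
  by apply: mk_endo => x y xy; apply/g0_hom/phiE; rewrite !psiK.
exists f, g; split=> [x|D]; first by rewrite gE fE phiK.
pose Dz := map psi D.
(* [D'] contains the points of [Dz] in [T] and, for each new point of [Dz], finitely many points of
   [T] through which all its relations with [T] pass. *)
have [D' [D'inl D'inr]] : exists D' : seq T, (forall x, inl x \in Dz -> x \in D') /\
    (forall k, inr k \in Dz -> 
      (forall x, q (inl x) (inr k) -> exists2 d, d \in D' &
        (x = d \/ tr /\ r x d) /\ q (inl d) (inr k)) /\
      (forall x, q (inr k) (inl x) -> exists2 d, d \in D' &
        (x = d \/ tr /\ r d x) /\ q (inr k) (inl d))).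
  elim: Dz => [|[x|k] l [D' [inlD inrD]]]; first by exists [::].
    exists (x :: D'); split=> [y|k]; rewrite inE.
      by move=> /orP[/eqP[->]|/inlD yD]; rewrite inE ?eqxx ?yD ?orbT.
    by move=> /= /inrD [H1 H2]; split=> y /[dup] yk; [move=> /H1|move=> /H2]; move=> [d dD H];
      exists d; rewrite // inE dD orbT.
  have [D1 D1P] : exists D1 : seq T, forall x, q (inl x) (inr k) -> exists2 d, d \in D1 &
      (x = d \/ tr /\ r x d) /\ q (inl d) (inr k) by exact: finitely_below.
  have [D2 D2P] : exists D2 : seq T, forall x, q (inr k) (inl x) -> exists2 d, d \in D2 &
      (x = d \/ tr /\ r d x) /\ q (inr k) (inl d) by exact: finitely_above.
  exists (D1 ++ D2 ++ D'); split=> [y|j]; rewrite inE.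
    by move=> /= /inlD; rewrite !mem_cat => ->; rewrite !orbT.
  move=> /orP[/eqP[->]|/inrD [H1 H2]]; split=> y yk.
  - by have [d dD H] := D1P y yk; exists d; rewrite // mem_cat dD.
  - by have [d dD H] := D2P y yk; exists d; rewrite // !mem_cat dD orbT.
  - by have [d dD H] := H1 y yk; exists d; rewrite // !mem_cat dD !orbT.
  - by have [d dD H] := H2 y yk; exists d; rewrite // !mem_cat dD !orbT.
exists D' => s' s's F.
have s'_hom x y : looped x y -> looped (s' x) (s' y) by exact: (@endo_edge X).
pose h (z : Z) := if z is inl x then s' x else g0 z.
pose Q (z : Z) := z \in Dz \/ exists x, z = inl x.
have h_inl z x : Q z -> (q z (inl x) -> looped (h z) (s' x)) /\
    (q (inl x) z -> looped (s' x) (h z)).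
  case=> [|[y ->]]; last by split=> /q_inl /rX; exact: s'_hom.
  case: z => [y _|k kD]; first by split=> /q_inl /rX; exact: s'_hom.
  have [below_k above_k] := D'inr k kD; split.
    move=> /above_k [d dD' [xd /g0_hom kd]]; rewrite /= -(s's d dD') in kd.
    by case: xd => [->//|[tt dx]]; exact: looped_trans tt _ _ _ kd (s'_hom _ _ (rX dx)).
  move=> /below_k [d dD' [xd /g0_hom kd]]; rewrite /= -(s's d dD') in kd.
  by case: xd => [->//|[tt dx]]; exact: looped_trans tt _ _ _ (s'_hom _ _ (rX dx)) kd.
have [l [ql Dl Fl lh]] : exists l : seq (Z * Z), [/\ partial_isomorphism q q l,
    {in Dz, forall d, (d, d) \in l}, {in F, forall x, inl x \in map fst l} &
    {in l, forall p, Q p.1 /\ g0 p.2 = h p.1}].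
  elim: F => [|x F [l [ql Dl Fl lh]]].
    exists [seq (d, d) | d <- Dz]; split => //.
    - by move=> _ _ /mapP[a _ ->] /mapP[b _ ->].
    - by move=> d dD; apply/mapP; exists d.
    - move=> _ /mapP[d dD ->] /=; split; first by left.
      by case: d dD => [x|//] /D'inl xD' /=; rewrite s's.
  have [xl|xl] := boolP (inl x \in map fst l).
    by exists l; split => // y; rewrite inE => /orP[/eqP->|/Fl].
  (* The image of [inl x] is chosen to realize the transported type and to have value [s' x] under
     [g0]; [h_inl] makes this request consistent. *)
  have [|||b bP bx] := @free_extension_realizes sym tr T T r looped s t0 (map snd l)
      (image_below q l (inl x)) (image_above q l (inl x)) (s' x).
  - exact: image_one_point_type.
  - move=> _ _ [p pl [<- px]]; have [Qp] := lh p pl; rewrite /g0 => ->.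
    exact: (h_inl _ _ Qp).1.
  - move=> _ _ [p pl [<- px]]; have [Qp] := lh p pl; rewrite /g0 => ->.
    exact: (h_inl _ _ Qp).2.
  exists ((inl x, b) :: l); split.
  - exact: (partial_isomorphism_cons qC qC).
  - by move=> d /Dl dl; rewrite inE dl orbT.
  - by move=> y; rewrite inE /= inE => /orP[/eqP->|/Fl ->]; rewrite ?eqxx ?orbT.
  - by move=> p; rewrite inE => /orP[/eqP->|/lh//]; split => //; right; exists x.
have [th [th' [thK th'K thE thl]]] := back_and_forth qC qC qE qE ql.
have [t tE] : {t : endo X | forall x, t x = phi (th (psi x))}.
  by apply: mk_endo => x y xy; left; apply/phiE; apply: (thE _ _).1; apply/phiE; rewrite !psiK.
have [t' t'E] : {t' : endo X | forall x, t' x = phi (th' (psi x))}.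
  by apply: mk_endo => x y xy; left; apply/phiE; apply: (thE _ _).2; rewrite !th'K; apply/phiE; rewrite !psiK.
exists t, t'; split.
- by split=> x; rewrite tE t'E ?phiK ?thK ?th'K psiK.
- by move=> x xD; rewrite tE (thl (psi x, psi x)) ?psiK //; exact/Dl/map_f.
- move=> x /Fl /mapP[p pl xp]; rewrite gE tE fE !phiK xp (thl p pl).
  by have [_ ->] := lh p pl; rewrite -xp.
Qed.

(** The free extension of [q] with values in [unit], where all pairs are related, has the extension
    property; back-and-forth from the pair [(m0, x0)] identifies it with [T]. *)
Lemma exists_embedding (M : countType) (q : M -> M -> Prop) (m0 : M) (x0 : T) :
  relation_class sym tr q -> exists f : M -> T,
    [/\ injective f, forall x y, q x y <-> r (f x) (f y) & f m0 = x0].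
Proof.
move=> qC; have [qI _ _] := qC; have [rI _ _] := rC.
pose z := free_extension sym tr q (fun _ _ : unit => True) (fun=> tt) tt.
have zC : relation_class sym tr z by exact: free_extension_class.
have zE : extension_property sym tr z.
  by apply: free_extension_EP => // L U _ _; exists tt.
have zq x y : z (inl x) (inl y) <-> q x y by exact: free_extension_inl.
have [|phi [psi [phiK psiK phiE phi0]]] :=
    @back_and_forth sym tr (M + nat)%type T z r [:: (inl m0, x0)] zC rC zE rE.
  move=> _ _ /[1!inE] /eqP-> /[1!inE] /eqP-> /=.
  by split; split => // [/zq/qI|/rI].
exists (phi \o inl); split => [x y /= /(can_inj phiK) [->]//|x y /=|].
  by rewrite -phiE zq.
by rewrite /= (phi0 (inl m0, x0)) ?mem_head.
Qed.

(* [c] and [c'] embed the structure in which [y] is replaced by two twins. *)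
Lemma exists_twin_endomorphisms (y : T) : exists c c' : endo X,
  forall x, c x = c' x <-> x <> y.
Proof.
pose fold a := odflt y a.
have [rI rS rT] := rC.
have qC : relation_class sym tr (fun a b => r (fold a) (fold b)).
  by split=> [a|sy a b|tt a b d]; [exact: rI | exact: rS | exact: rT].
have [f [fI fE _]] := exists_embedding None y qC.
have [c cE] : {c : endo X | forall x, c x = f (Some x)}.
  by apply: mk_endo => x z xz; left; apply/fE.
have [c' c'E] : {c : endo X | forall x, c x = f (if x == y then None else Some x)}.
  by apply: mk_endo => x z xz; left; apply/fE; do 2 case: eqP => [?|_]; subst.
exists c, c' => x; rewrite cE c'E; case: eqP => [xy|//].
by split => [/fI|].
Qed.

(* The ranges of [a] and [a'] meet in [x] only, and any two of their points are
   adjacent: hence [f] maps [x] to [y] as soon as [y] is in the range of both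
   [a * f] and [a' * f]. *)
Lemma exists_transverse_endomorphisms (x : T) : exists a a' : endo X,
  [/\ a x = x, a' x = x & forall p p', a p = a' p' /\ a p = x \/
     r (a p) (a' p') \/ r (a' p') (a p)].
Proof.
have [rI rS rT] := rC.
(* Two copies of [T] in which any two distinct points are adjacent: a complete graph or, for orders,
   a linear extension refined lexicographically by [bool]. *)
have [q [qC rq qtot]] : exists q : T * bool -> T * bool -> Prop,
    [/\ relation_class sym tr q,
       forall u v i j, r u v -> q (u, i) (v, j) &
       forall u v, u <> v -> q u v \/ q v u].
  have [tt|ntt] := boolP tr; last first.
    exists (fun u v => u <> v); split.
    - by split; [move=> u; apply | move=> _ u v uv /esym | ].
    - by move=> u v i j uv [uv' _]; apply: (rI u); rewrite {2}uv'.
    - by move=> u v; left.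
  have nsy : ~~ sym by apply: contraNN symtr => ->.
  have [l [lI lT lr ltot]] := exists_linear_extension rI (rT tt).
  exists (fun u v => l u.1 v.1 \/ u.1 = v.1 /\ ~~ u.2 && v.2); split.
  - split=> [[u i] /= [/lI//|[_]]|sy|_ [u i] [v j] [w k] /=].
    + by case: i.
    + by rewrite sy in nsy.
    + move=> [uv|[-> ij]] [vw|[<- jk]]; [left|by left|by left|].
        exact: lT uv vw.
      by case/andP: ij jk => _ ->.
  - by move=> u v i j /lr; left.
  - move=> [u i] [v j] /= uv; have [uv1|] := pselect (u = v); last first.
      by move=> /ltot [?|?]; [left; left | right; left].
    subst v; case: i j uv => -[] // _; [right|left]; right; by [].
have [f [_ fE fx]] := exists_embedding (x, false) x qC.
pose F i p := f (if p == x then (x, false) else (p, i)).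
have Fr i u v : r u v -> looped (F i u) (F i v).
  move=> uv; left; apply/fE.
  by do 2 case: eqP => [?|_]; subst; exact: rq.
have [a aE] := mk_endo (@Fr false); have [a' a'E] := mk_endo (@Fr true).
exists a, a'; split; rewrite ?aE ?a'E /F ?eqxx // => p p'.
rewrite aE a'E /F.
set u := if _ then _ else _; set v := if _ then _ else _.
have [uv|/qtot[/fE|/fE]] := pselect (u = v); [left | by right; left | by right; right].
rewrite uv; split => //; rewrite -fx; congr f; move: uv; rewrite /u /v.
by case: (p' =P x) => // _; case: (p =P x) => // _ [].
Qed.

(** The twins [c] and [c'] express by an inequation that [y] is in the range of [a * f]. With loops,
    [a] is constant at [x]. Without loops, the two transverse maps are used: adjacent preimages of
    [y] would give a loop at [y]. *)
Lemma zariski_open_looped (x y : T) : zariski_open [set f : endo X | f x = y].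
Proof.
have [rI _ _] := rC.
have [c [c' cc']] := exists_twin_endomorphisms y.
have rangeP (a f : endo X) : (a * f * c)%g <> (a * f * c')%g <-> exists p, f (a p) = y.
  split=> [acc'|[p fap] /(congr1 (fun g : endo X => g p)) /= /cc'//].
  apply: contrapT => nfa; apply: acc'; apply: endo_ext => p /=.
  by apply/cc' => fap; apply: nfa; exists p.
have [ll|nll] := boolP loops.
  have [a aE] := mk_endo (fun _ _ _ => or_intror (conj ll (erefl x))).
  rewrite (_ : [set _ | _] = [set f : endo X | (a * f * c)%g <> (a * f * c')%g]).
    exact: zariski_neq.
  apply/seteqP; split=> f /= => [fx|/rangeP [p]]; last by rewrite aE.
  by apply/rangeP; exists x; rewrite aE.
have [a [a' [ax a'x aa']]] := exists_transverse_endomorphisms x.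
rewrite (_ : [set _ | _] = [set f : endo X | (a * f * c)%g <> (a * f * c')%g] `&`
    [set f : endo X | (a' * f * c)%g <> (a' * f * c')%g]).
  by apply: zariski_setI; exact: zariski_neq.
apply/seteqP; split=> f /=.
  by move=> fx; split; apply/rangeP; exists x; rewrite ?ax ?a'x.
move=> [/rangeP [p fp] /rangeP [p' fp']].
have f_r u v : r u v -> r (f u) (f v).
  by move=> /rX /(@endo_edge X f) [//|[ll]]; rewrite ll in nll.
have [[_ <-]//|[/f_r|/f_r]] := aa' p p'; rewrite fp fp' => /rI //.
Qed.

Lemma unique_polish_looped (R : realType) : pointwise_unique_polish R X.
Proof.
apply: pointwise_unique_polish_criterion; last exact: automorphism_approximable_looped.
exact: zariski_open_looped.
Qed.

End HomogeneousStructure.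

Theorem unique_polish_fraisse_limit (R : realType) (sym tr : bool)
    (C : structure -> Prop) (X : structure) : ~~ (sym && tr) ->
  (forall A : structure, C A <-> relation_class sym tr (@edge A)) ->
  fraisse_limit C X ->
  pointwise_unique_polish R X /\ pointwise_unique_polish R (with_loops X).
Proof.
move=> symtr CE; case: X => A r XF.
(* Countability turns the domain into a [countType], whose codes drive all the enumerations. *)
have [cA _ _] := XF; have [T AT] := Pcountable cA; rewrite /= in AT; subst A.
have rC := fraisse_limit_class CE XF; have rE := fraisse_limit_EP CE XF.
split.
  rewrite (_ : Structure r = Structure (looped false r)).
    exact: unique_polish_looped rC rE R.
  by apply: structure_iff => x y; split=> [|[|[]]//]; left.
rewrite (_ : with_loops _ = Structure (looped true r)).
  exact: unique_polish_looped rC rE R.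
by apply: structure_iff => x y; split=> [[|->]|[|[]]] /=; [left|right|left|right].
Qed.

Theorem corollaryC (R : realType) :
  (forall X : structure, random_graph X ->
     pointwise_unique_polish R X /\
     pointwise_unique_polish R (with_loops X)) /\
  (forall X : structure, random_directed_graph X ->
     pointwise_unique_polish R X /\
     pointwise_unique_polish R (with_loops X)) /\
  (forall X : structure, random_strict_partial_order X ->
     pointwise_unique_polish R X /\
     pointwise_unique_polish R (with_loops X)) /\
  (forall n : nat, (0 < n)%N ->
     pointwise_unique_polish R (disjoint_copies nat (complete_graph 'I_n)) /\
     pointwise_unique_polish R
       (with_loops (disjoint_copies nat (complete_graph 'I_n)))) /\
  (forall n : nat, (0 < n)%N ->
     pointwise_unique_polish R
       (with_loops (disjoint_copies 'I_n (complete_graph nat)))) /\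
  pointwise_unique_polish R
    (with_loops (disjoint_copies nat (complete_graph nat))).
Proof.
split; [|split; [|split; [|split; [|split]]]].
- move=> X; apply: (@unique_polish_fraisse_limit R true false) => // A.
  by split=> [[I S]|[I S _]]; split => //; exact: S.
- move=> X; apply: (@unique_polish_fraisse_limit R false false) => // A.
  by split=> [I|[I _ _]//]; split.
- move=> X; apply: (@unique_polish_fraisse_limit R false true) => // A.
  by split=> [[I S]|[I _ S]]; split => //; exact: S.
- by move=> n _; exact: unique_polish_finite_classes.
- by move=> n _; exact: unique_polish_finitely_many_infinite_classes.
- exact: unique_polish_infinitely_many_infinite_classes.
Qed.
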